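(* There exists a Monte Carlo algorithm which solves \textsc{Equal-Subset-Sum} on $n$ input integers in polynomial space and $\mathcal{O}^{*}(2^{1.5n})\le\mathcal{O}^{*}(2.8285^n)$ time. The algorithm assumes random read-only access to exponentially many random bits.
   Context: \textsc{Equal-Subset-Sum}: given a set $S$ of $n$ integers, decide whether there exist two disjoint nonempty subsets $A,B\subseteq S$ with $\sum_{a\in A}a=\sum_{b\in B}b$. The notation $\mathcal{O}^{*}(\cdot)$ hides factors polynomial in the input size. *)

(* Defs.v *)
From mathcomp Require Import all_boot all_order all_algebra finmap.
From mathcomp Require Import boolp classical_sets reals exp.

Set Implicit Arguments.
Unset Strict Implicit.
Unset Printing Implicit Defensive.

Import Order.TTheory GRing.Theory Num.Theory.
Local Open Scope ring_scope.

Definition equal_subset_sum (S : {fset int}) : Prop :=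
  exists A B : {fset int},
    [/\ (A `<=` S)%fset, (B `<=` S)%fset, [disjoint A & B]%fset,
        A != fset0 /\ B != fset0
      & \sum_(a <- A) a = \sum_(b <- B) b].

(* Length of the binary representation of z, plus one sign bit. *)
Definition bitlen (z : int) : nat := (trunc_log 2 `|z|).+2.

(* An input is a duplicate-free list enumerating the set S of integers; its
   length is n. *)
Definition input_size (s : seq int) : nat := (\sum_(z <- s) bitlen z)%N.

(* A random access machine with integer cells.  Its only arithmetic is addition
   and subtraction, so an instruction takes time polynomial in the number of
   bits in memory: up to factors polynomial in the space, counting instructions
   is the same as counting bit operations. *)
Inductive instr : Type :=
  | IConst of nat & int        (* M[d] := z *)
  | IAdd of nat & nat & nat    (* M[d] := M[a] + M[b] *)
  | ISub of nat & nat & nat    (* M[d] := M[a] - M[b] *)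
  | ILoad of nat & nat         (* M[d] := M[ |M[a]| ] *)
  | IStore of nat & nat        (* M[ |M[d]| ] := M[a] *)
  | IRand of nat & nat         (* M[d] := random bit number |M[a]| *)
  | IJump of nat               (* goto l *)
  | IJumpPos of nat & nat.     (* if 0 < M[a] then goto l *)

Definition program := seq instr.

(* [cells] lists the cells from address 0 on; cells past its end contain 0, and
   writing past the end pads with 0. *)
Record state := State { pc : nat; cells : seq int }.

Definition peek (c : state) (a : nat) : int := nth 0 (cells c) a.

Definition put (c : state) (a : nat) (z : int) : state :=
  State (pc c).+1 (set_nth 0 (cells c) a z).

(* [rnd] is the read-only string of random bits. *)
Definition exec (rnd : seq bool) (i : instr) (c : state) : state :=
  match i with
  | IConst d z => put c d z
  | IAdd d a b => put c d (peek c a + peek c b)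
  | ISub d a b => put c d (peek c a - peek c b)
  | ILoad d a => put c d (peek c `|peek c a|%N)
  | IStore d a => put c `|peek c d|%N (peek c a)
  | IRand d a => put c d (nat_of_bool (nth false rnd `|peek c a|%N))%:Z
  | IJump l => State l (cells c)
  | IJumpPos a l => State (if 0 < peek c a then l else (pc c).+1) (cells c)
  end.

Definition step (P : program) (rnd : seq bool) (c : state) : state :=
  if onth P (pc c) is Some i then exec rnd i c else c.

Definition halted (P : program) (c : state) : bool := (size P <= pc c)%N.

Definition init (s : seq int) : state := State 0 ((size s)%:Z :: s).

Definition run (P : program) (rnd : seq bool) (s : seq int) (t : nat) : state :=
  iter t (step P rnd) (init s).

Definition accepts (c : state) : bool := peek c 0 != 0.

(* Every cell up to the highest one written so far is charged. *)
Definition space (c : state) : nat := (\sum_(z <- cells c) bitlen z)%N.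

Definition prob (m : nat) (E : pred (m.-tuple bool)) : rat :=
  #|[set r | E r]|%:R / #|{: m.-tuple bool}|%:R.

(* On every input s the program is given 2 ^ q(input_size s) uniform random
   bits.  It halts within T s steps for every value of these bits, and its
   answer is correct with probability at least 2/3. *)
Definition monte_carlo_solves (D : {fset int} -> Prop) (P : program)
    (q : {poly nat}) (T : seq int -> nat) : Prop :=
  forall s : seq int, uniq s ->
    let m := (2 ^ q.[input_size s])%N in
    (forall r : m.-tuple bool, halted P (run P r s (T s))) /\
    2 / 3 <= prob (fun r : m.-tuple bool =>
      accepts (run P r s (T s)) == `[< D [fset x in s]%fset >]).

Definition polynomial_space (P : program) (q : {poly nat}) : Prop :=
  exists p : {poly nat}, forall s : seq int, uniq s ->
    forall (r : (2 ^ q.[input_size s])%N.-tuple bool) (t : nat),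
      (space (run P r s t) <= p.[input_size s])%N.

(* O^*(g(n)), as a set of functions of the input, n being the number of input
   integers. *)
Definition Ostar (R : realType) (g : nat -> R) : set (seq int -> nat) :=
  [set T | exists p : {poly nat}, forall s : seq int, uniq s ->
     (T s)%:R <= (p.[input_size s])%:R * g (size s)]%classic.

(* Main.v *)
(* A solution is the same as a pair of incomparable index sets with equal sums,
   so it is enough to find, among the N = 2^n index sets, a colliding pair of
   this kind.  One trial walks v -> sum of the set h(v), where h maps integers to
   index sets and is read off a fresh block of random bits, and looks with
   Floyd's algorithm at the first repetition of the walk, for about sqrt N steps.

   Let S be the number of ordered pairs of sets with equal sums.  Sets of equal
   cardinality are incomparable unless equal, so if S >= 2 (n+1) N, then the
   Cauchy-Schwarz inequality over the cardinalities gives N incomparable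
   colliding pairs, and the first two sets of the walk form one with
   probability at least 1/N.  Otherwise a union bound shows that a walk of
   sqrt (N / 8 (n+1)) steps has no accidental repetition with constant
   probability, so the walk runs first into a given u and later into its partner
   v with probability at least 1 / (128 (n+1) N).  A number of independent trials
   proportional to n N then suffices, each taking sqrt N steps up to
   polynomial factors. *)

Require Import Defs.
From mathcomp Require Import all_boot all_order all_algebra finmap.
From mathcomp Require Import boolp classical_sets reals exp.
From mathcomp Require Import zify ring lra.

Set Implicit Arguments.
Unset Strict Implicit.
Unset Printing Implicit Defensive.

(** * Random walks on a finite set *)

(** Storing the walk or h would take exponential space; Floyd's algorithm keeps a constant number of
    vertices, and h is read again from the random bits whenever it is needed. The walk starts at an
    integer that is no subset sum, so its first repeated vertex has two distinct predecessors on the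
    walk, and these carry the two sets wanted. The vertices are chosen adaptively, which obstructs
    independence. The remedy is to fix the tuple of sets that h returns along the walk: it
    determines the vertices, and if these are distinct, a block agrees with the tuple with
    probability exactly N^-(j+1). Probabilities thus become counts of tuples, compared by
    cross-multiplication of natural numbers. The tuples with u at one of l+1 places, v last and no
    repetition among the other sums have total probability of order (l+1)/N^2; summing over l up to
    a multiple of sqrt(N/(n+1)) gives the order 1/(nN). Errors are one-sided, as every accepted pair
    is verified. On the machine the obstacle is that the input fills the memory from the lowest
    cells on, so room for registers must be made first. *)

Section Floyd.
Variables (X : eqType) (g : X -> X) (x0 : X).
Local Notation walk i := (iter i g x0).

(** Records the last meeting up to step t, not the first: a machine that overwrites its record at
    every meeting then needs no test for the first one. The default [x0] is the record before any
    meeting. *)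
Fixpoint meet (t : nat) : X :=
  if t is t'.+1 then
    if walk t == walk (t + t) then walk t else meet t'
  else x0.

Lemma meetP t :
  (exists2 k, 0 < k <= t & walk k = walk (k + k)) ->
  exists k, [/\ 0 < k, walk k = walk (k + k) & meet t = walk k].
Proof.
elim: t => [|t IH] [k /andP[k0 kt] Ek]; first by lia.
rewrite /=; case: ifP => [/eqP E|/eqP NE]; first by exists t.+1.
apply: IH; exists k => //; rewrite k0 /= -ltnS ltn_neqAle kt andbT.
by apply/eqP => ke; case: NE; move: Ek; rewrite ke.
Qed.

Variables i j : nat.
Hypothesis lt_ij : i < j.
Hypothesis uniq_walk : uniq (mkseq (fun k => walk k) j.+1).
Hypothesis walk_hit : walk j.+1 = walk i.+1.

(** The cycle consists of the indices i+1 to j and has length j - i; for a > i this is the index in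
    it of the vertex reached at time a. *)
Let rho a := i.+1 + (a - i.+1) %% (j - i).

Lemma walk_rho a : i < a -> walk a = walk (rho a).
Proof.
move=> ia; rewrite /rho -{1}(subnKC ia); move: (a - i.+1) => d {a ia}.
elim/ltn_ind: d => d IH.
case: (ltnP d (j - i)) => [lt|le]; first by rewrite modn_small.
have -> : i.+1 + d = d - (j - i) + j.+1 by lia.
rewrite iterD walk_hit -iterD addnC IH; last by lia.
by rewrite -[in RHS](subnK le) modnDr.
Qed.

Lemma walk_inj a b : a <= j -> b <= j -> walk a = walk b -> a = b.
Proof.
move=> aj bj E; apply/eqP.
rewrite -(nth_uniq x0 _ _ uniq_walk) ?size_mkseq ?ltnS //.
by rewrite !nth_mkseq ?ltnS // E.
Qed.

Lemma rho_le a : rho a <= j.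
Proof.
have : (a - i.+1) %% (j - i) < j - i by rewrite ltn_mod; lia.
by rewrite /rho; lia.
Qed.

(** No meeting happens on the tail: for k <= i the doubled index either stays within the injective
    range up to j or lands on the cycle. On the cycle, k and 2k agree modulo its length. *)
Lemma dvdn_period k : 0 < k -> walk k = walk (k + k) ->
  (j - i %| k) /\ i < k.
Proof.
move=> k0 E; case: (ltnP i k) => [ik|ki].
  split=> //; move: E; rewrite walk_rho // (walk_rho (a := k + k)); last by lia.
  move/(walk_inj (rho_le _) (rho_le _)) => /addnI /eqP.
  have -> : k + k - i.+1 = k + (k - i.+1) by lia.
  by rewrite -[X in X %% _ == _]add0n eqn_modDr mod0n eq_sym.
case: (leqP (k + k) j) => [kj|jk].
  by have := walk_inj _ kj E; lia.
rewrite (walk_rho (a := k + k)) in E; last by lia.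
by have := walk_inj _ (rho_le _) E; rewrite /rho; lia.
Qed.

(* Walking from the start and from the meeting point in parallel passes through
   the two distinct predecessors of the first repeated vertex. *)
Lemma floyd t : j <= t -> iter i g (meet t) = walk j.
Proof.
move=> jt; have [|k [k0 Ek ->]] := @meetP t.
  (* The least multiple of the cycle length above i. It is at most j, so a meeting occurs within t
     steps. *)
  exists ((i %/ (j - i)).+1 * (j - i)).
    rewrite muln_gt0 /=; have := leq_divM i (j - i); rewrite mulSn; lia.
  have le : i < (i %/ (j - i)).+1 * (j - i) by rewrite ltn_ceil // subn_gt0.
  rewrite walk_rho // [RHS]walk_rho; last by lia.
  congr (walk _); rewrite /rho; congr addn.
  by rewrite -addnBA // modnMDl.
have [dk ik] := dvdn_period k0 Ek.
rewrite -iterD walk_rho; last by lia.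
congr (walk _); rewrite /rho.
(* As k is a multiple of the cycle length, time i + k is one step before the cycle entry modulo that
   length, which is position j. Taking one full length out of k keeps the truncated subtraction
   exact. *)
have -> : i + k - i.+1 = (k - (j - i)) + (j - i).-1.
  by have := dvdn_leq k0 dk; lia.
rewrite -modnDml (eqP (_ : j - i %| k - (j - i))).
  by rewrite add0n modn_small; lia.
by rewrite dvdn_subr // dvdn_leq.
Qed.

End Floyd.

(** * Sums over tuples *)

Section TupleSums.
Variable X : finType.

Lemma big_tuple0 (F : 0.-tuple X -> nat) : \sum_(z : 0.-tuple X) F z = F [tuple].
Proof. by rewrite (big_pred1 [tuple]) // => z; apply/esym/eqP; exact: tuple0. Qed.

Lemma big_tcons l (F : l.+1.-tuple X -> nat) :
  \sum_(z : l.+1.-tuple X) F z =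
  \sum_(x : X) \sum_(z : l.-tuple X) F [tuple of x :: z].
Proof.
rewrite pair_big /=.
rewrite (reindex (fun p : X * l.-tuple X => [tuple of p.1 :: p.2])) //=.
exists (fun z => (thead z, [tuple of behead z])) => [[x z] _|z _] /=.
  by congr pair; apply: val_inj.
by rewrite [RHS]tuple_eta.
Qed.

(** Linearity of expectation over the l coordinates; the factor [#|X|] on the left avoids the
    exponent l - 1. *)
Lemma sum_tuple_sum l (m : X -> nat) :
  #|X| * \sum_(z : l.-tuple X) \sum_(a <- z) m a =
  l * #|X| ^ l * \sum_x m x.
Proof.
elim: l => [|l IH]; first by rewrite big_tuple0 big_nil muln0.
rewrite big_tcons.
under eq_bigr => x _ do under eq_bigr => z _ do rewrite big_cons.
under eq_bigr => x _ do
  rewrite big_split /= big_const iter_addn_0 card_tuple.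
rewrite big_split /= -big_distrl /= big_const iter_addn_0.
have -> : #|(xpredT : pred X)| = #|X| by apply: eq_card.
rewrite [X in _ * (_ + X)]mulnC IH expnS; ring.
Qed.

End TupleSums.

Lemma card_set_sum (T : finType) (P : pred T) : #|[set x | P x]| = \sum_x P x.
Proof.
by rewrite cardsE -sum1_card big_mkcond; apply: eq_bigr => x _; rewrite unfold_in; case: (P x).
Qed.

(** * Accidental repetitions among random values, and collisions within levels *)

Section Birthday.
Variables (X : finType) (V : eqType) (f : X -> V).

Definition mult (x : X) : nat := #|[set y | f y == f x]|.

Definition ncollisions : nat := \sum_x mult x.

Definition ninjective (u : X) (l : nat) : nat :=
  #|[set z : l.-tuple X | uniq (f u :: map f z)]|.

(** An injective tuple z extends by every x except those colliding with u or with an entry of z, and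
    the multiplicities of these entries bound the number of exceptions. *)
Lemma ninjectiveS u l :
  #|X| * ninjective u l <=
  ninjective u l.+1 + (#|X| ^ l * mult u +
    \sum_(z : l.-tuple X) \sum_(a <- z) mult a).
Proof.
have -> : #|X| ^ l * mult u + \sum_(z : l.-tuple X) \sum_(a <- z) mult a =
    \sum_(z : l.-tuple X) \sum_(a <- u :: z) mult a.
  under [RHS]eq_bigr => z _ do rewrite big_cons.
  by rewrite big_split /= sum_nat_const card_tuple.
have -> : ninjective u l.+1 =
    \sum_(z : l.-tuple X) uniq (f u :: map f z) *
       #|[set x | f x \notin f u :: map f z]|.
  rewrite /ninjective !card_set_sum big_tcons exchange_big.
  apply: eq_bigr => z _; rewrite card_set_sum big_distrr.
  apply: eq_bigr => x _; rewrite /= !inE !negb_or [f u == _]eq_sym.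
  by case: (f x == f u); case: (f u \in _); case: (f x \in _); case: (uniq _).
have -> : ninjective u l = \sum_(z : l.-tuple X) uniq (f u :: map f z).
  exact: card_set_sum.
rewrite big_distrr -big_split /=; apply: leq_sum => z _.
case U : (_ && _); rewrite ?muln0 // mul1n muln1.
have -> : #|X| = #|[set x | f x \notin f u :: map f z]| +
    #|[set x | f x \in f u :: map f z]|.
  rewrite addnC -cardsUI -[LHS]cardsT (_ : _ :&: _ = finset.set0) ?cards0 ?addn0.
    by apply: eq_card => x; rewrite !inE orbN.
  by apply/setP => x; rewrite !inE andbN.
rewrite leq_add2l.
rewrite -[f u :: map f z]/(map f (u :: z)).
elim: (u :: z) {U} => [|a r IH].
  by rewrite big_nil leqn0 cards_eq0; apply/eqP/setP => x; rewrite !inE.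
rewrite big_cons; apply: leq_trans (leq_add (leqnn _) IH).
apply: leq_trans (leq_card_setU _ _); apply: subset_leq_card.
by apply/fintype.subsetP => x; rewrite !inE.
Qed.

(* A union bound: [z] fails to be injective if some [z_k] collides with [u] or
   with an earlier entry. *)
Lemma ninjective_ge u l :
  #|X| ^ l.+2 <= #|X| ^ 2 * ninjective u l +
     #|X| ^ l * (l * mult u * #|X| + l ^ 2 * ncollisions).
Proof.
elim: l => [|l IH].
  rewrite [X in _ <= _ + X]muln0 addn0 (_ : ninjective _ _ = 1) ?muln1 //.
  rewrite /ninjective cardsE (eq_card (B := predT)) ?card_tuple //.
  by move=> z; rewrite !inE [z]tuple0.
have rec := ninjectiveS u l; have S := sum_tuple_sum l mult.
rewrite -/ncollisions in S.
set W := \sum_(z : l.-tuple X) _ in rec S.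
set c := ninjective u l in rec IH; set c' := ninjective u l.+1 in rec *.
set N := #|X| in rec IH S *; set m := mult u in rec IH *.
have rec2 : N * (N * c) * N <= N * N * c' + (N ^ l * N * N * m + N * (N * W)).
  have -> : N * N * c' + (N ^ l * N * N * m + N * (N * W)) =
     N * (c' + (N ^ l * m + W)) * N by ring.
  by rewrite leq_mul2r leq_mul2l rec !orbT.
have IH2 : N * N ^ l.+2 <= N * (N ^ 2 * c + N ^ l * (l * m * N + l ^ 2 * ncollisions)).
  by rewrite leq_mul2l IH orbT.
rewrite S in rec2.
rewrite !expnS in IH2 *; rewrite expn0 in IH2 *.
set A := N ^ l in rec2 IH2 *; nia.
Qed.

(** The fibre through u alone contributes this many ordered pairs. It lets a bound on [ncollisions]
    control also the repetitions caused by the fixed element u. *)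
Lemma mult_le u : mult u ^ 2 <= ncollisions.
Proof.
rewrite /ncollisions (bigID (fun x => f x == f u)) /=.
apply: leq_trans (leq_addr _ _).
rewrite (eq_bigr (fun=> mult u)) => [|x /eqP E]; last by rewrite /mult E.
by rewrite sum_nat_const /mult cardsE.
Qed.

(** In the union bound the hypothesis limits collisions among the entries to a fraction 1/4 and,
    through [mult_le], collisions with u to 1/2. A quarter of the tuples survives. *)
Lemma ninjective_ge4 u l :
  4 * l ^ 2 * ncollisions <= #|X| ^ 2 -> #|X| ^ l <= 4 * ninjective u l.
Proof.
move=> H; have := ninjective_ge u l; have mS := mult_le u.
have N0 : 0 < #|X| ^ 2 by rewrite expn_gt0; apply/orP; left; apply/card_gt0P; exists u.
have lm : 2 * (l * mult u) <= #|X|.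
  rewrite -leq_sqr !expnMn; apply: leq_trans H; rewrite -mulnA leq_mul2l /=.
  by rewrite leq_mul2l mS orbT.
rewrite -[l.+2]add2n expnD => G.
rewrite -(leq_pmul2l N0).
have E1 : #|X| ^ l * (2 * (l * mult u * #|X|)) <= #|X| ^ l * #|X| ^ 2.
  by rewrite leq_mul2l; apply/orP; right; nia.
have E2 : #|X| ^ l * (4 * (l ^ 2 * ncollisions)) <= #|X| ^ l * #|X| ^ 2.
  by rewrite leq_mul2l; apply/orP; right; rewrite mulnA.
move: E1 E2 G; set A := #|X| ^ l; set B := #|X| ^ 2; set c := ninjective u l.
set p := l * mult u * #|X|; set q := l ^ 2 * ncollisions; nia.
Qed.

Lemma ncollisionsE : ncollisions = #|[set p : X * X | f p.1 == f p.2]|.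
Proof.
rewrite card_set_sum -(pair_big predT predT (fun x y => nat_of_bool (f x == f y))) /=.
apply: eq_bigr => x _; rewrite /mult card_set_sum.
by apply: eq_bigr => y _; rewrite eq_sym.
Qed.

End Birthday.

(* Cauchy-Schwarz inside every fibre of [f]. *)
Lemma card_collisions_level_fin (X V L : finType) (f : X -> V) (lev : X -> L) :
  #|[set p : X * X | f p.1 == f p.2]| <=
  #|L| * #|[set p : X * X | (f p.1 == f p.2) && (lev p.1 == lev p.2)]|.
Proof.
pose c v l := #|[set x | (f x == v) && (lev x == l)]|.
(* One count for an arbitrary relation between the levels: both sides of the inequality are
   instances, with P full and with P the equality. *)
have E (P : rel L) : #|[set p : X * X | (f p.1 == f p.2) && P (lev p.1) (lev p.2)]| =
    \sum_v \sum_l \sum_(l' | P l l') c v l * c v l'.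
  rewrite -sum1_card (partition_big (fun p : X * X => f p.1) predT) //=.
  apply: eq_bigr => v _.
  rewrite (partition_big (fun p : X * X => lev p.1) predT) //=.
  apply: eq_bigr => l _.
  rewrite (partition_big (fun p : X * X => lev p.2) (P l)) /=; last first.
    by move=> p; rewrite !inE => /andP[/andP[/andP[_ Pp] _] /eqP <-].
  apply: eq_bigr => l' Pl; rewrite sum1_card -cardsX; apply: eq_card => -[x y].
  rewrite !inE /= unfold_in /= !inE /=.
  case: (f x =P v) => [->|]; rewrite ?andbF //= andbT.
  case: (lev x =P l) => [->|]; rewrite ?andbF //= andbT.
  case: (lev y =P l') => [->|]; rewrite ?andbF //= andbT.
  by rewrite Pl eq_sym !andbT.
have -> : #|[set p : X * X | f p.1 == f p.2]| = \sum_v \sum_l \sum_l' c v l * c v l'.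
  rewrite -(E (fun _ _ => true)); apply: eq_card => p.
  by rewrite !inE andbT.
rewrite E big_distrr /=; apply: leq_sum => v _.
have -> : \sum_l \sum_(l' | l == l') c v l * c v l' = \sum_l c v l ^ 2.
  by apply: eq_bigr => l _; rewrite (big_pred1 l) // => l'; rewrite eq_sym.
(* Doubling prepares for 2ab <= a^2 + b^2, applied to each pair of levels. *)
rewrite -(leq_pmul2l (ltn0Sn 1)).
have -> : 2 * (#|L| * \sum_l c v l ^ 2) =
    \sum_l \sum_l' (c v l ^ 2 + c v l' ^ 2).
  under [RHS]eq_bigr => l _ do rewrite big_split /= sum_nat_const.
  by rewrite big_split /= -big_distrr /= sum_nat_const mul2n addnn.
rewrite big_distrr; apply: leq_sum => l _ /=; rewrite big_distrr; apply: leq_sum => l' _.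
by rewrite /= nat_Cauchy.
Qed.

(** The sums lie in an infinite type. Sending x to its fibre, a finite set, produces the same
    collisions with a finite codomain. *)
Lemma card_collisions_level (X L : finType) (V : eqType) (f : X -> V)
    (lev : X -> L) :
  #|[set p : X * X | f p.1 == f p.2]| <=
  #|L| * #|[set p : X * X | (f p.1 == f p.2) && (lev p.1 == lev p.2)]|.
Proof.
pose F x := [set y | f y == f x].
have EF x y : (F x == F y) = (f x == f y).
  apply/eqP/eqP => [/setP/(_ x)|E]; last by rewrite /F E.
  by rewrite !inE eqxx => /esym/eqP.
have := card_collisions_level_fin F lev.
by congr (_ <= _ * _); apply: eq_card => p; rewrite !inE EF.
Qed.

(** * The walk driven by a random function *)

Section HashWalk.
Variables (W X : finType) (V : eqType) (f : X -> V) (v0 : V) (h : W -> V -> X).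

Definition hwalk (b : W) (i : nat) : V := iter i (fun v => f (h b v)) v0.

(** Equality is required of the successors, because the useful sets are those chosen at the two
    predecessors i and j of the first repeated vertex. *)
Definition first_hit (inc : rel X) (b : W) (j : nat) : bool :=
  uniq (mkseq (hwalk b) j.+1) &&
  [exists i : 'I_j, (hwalk b j.+1 == hwalk b i.+1) &&
     inc (h b (hwalk b i)) (h b (hwalk b j))].

Definition hashed (b : W) (j : nat) : j.+1.-tuple X :=
  [tuple h b (hwalk b i) | i < j.+1].

Lemma nth_hashed b j i x : i <= j -> nth x (hashed b j) i = h b (hwalk b i).
Proof.
move=> ij; rewrite -[i]/(val (Ordinal (ij : i < j.+1))) -tnth_nth.
by rewrite tnth_mktuple.
Qed.

(** The sets returned so far determine all later queries: each vertex is the image under f of the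
    set chosen just before it. *)
Lemma hwalk_nth b (ys : seq X) i :
  map (h b) (v0 :: map f (take (size ys).-1 ys)) = ys -> i < size ys ->
  hwalk b i = nth v0 (v0 :: map f (take (size ys).-1 ys)) i.
Proof.
set ws := v0 :: _ => E; elim: i => [//|i IH] lt.
have sw : size ws = size ys by rewrite -E size_map.
have y0 : X by case: (ys) lt.
have lt' : i < (size ys).-1 by lia.
rewrite /hwalk iterS -/(hwalk b i) IH ?(ltnW lt) //.
rewrite -(nth_map v0 y0) ?sw ?(ltnW lt) // E /ws /=.
by rewrite (nth_map y0) ?nth_take // size_takel // leq_pred.
Qed.

Hypothesis v0P : forall x, f x != v0.
Hypothesis hash_uniform : forall (ws : seq V) (ys : seq X),
  uniq ws -> {in ws, forall w, w = v0 \/ exists x, w = f x} ->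
  size ys = size ws ->
  #|[set b | map (h b) ws == ys]| * #|X| ^ size ws = #|W|.

(** Deferred decisions: a tuple in A forces the queries [v0], f y_0, ..., f y_(j-1), which are
    distinct, so exactly a fraction N^-(j+1) of the blocks answers them by that tuple, with N =
    [#|X|]. Different tuples come from disjoint sets of blocks. *)
Lemma hashed_in j (A : {set j.+1.-tuple X}) :
  (forall ys : j.+1.-tuple X, ys \in A -> uniq (map f (take j ys))) ->
  #|A| * #|W| <= #|X| ^ j.+1 * #|[set b | hashed b j \in A]|.
Proof.
move=> HA.
rewrite -sum1_card [X in _ <= _ * X]cardsE -sum1_card /= (partition_big (fun b => hashed b j) (mem A)) //=.
rewrite big_distrl big_distrr /=; apply: leq_sum => ys yA.
rewrite mul1n -(hash_uniform (ws := v0 :: map f (take j ys)) (ys := ys)); last 3 first.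
- rewrite cons_uniq HA // andbT; apply/mapP => -[x _ /esym/eqP]; exact/negP.
- by move=> w; rewrite inE => /predU1P[|/mapP[x _ ->]]; [left|right; exists x].
- by rewrite /= size_map size_takel ?size_tuple.
rewrite /= size_map size_takel ?size_tuple // mulnC leq_mul2l; apply/orP; right.
rewrite -[X in X <= _]sum1_card /= big_mkcond [X in _ <= X]big_mkcond /=.
apply: leq_sum => b _; rewrite inE; case: ifP => // /eqP E.
suff eb : hashed b j = ys by rewrite -[b \in _]/(hashed b j \in A) eb yA eqxx.
have y0 : X by case: (ys) => -[].
apply: (@eq_from_tnth _ _ _ _) => i; rewrite !(tnth_nth y0) nth_hashed; last by rewrite -ltnS.
have E' : map (h b) (v0 :: map f (take (size ys).-1 ys)) = ys by rewrite size_tuple.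
have si : i < size ys by rewrite size_tuple.
rewrite (hwalk_nth E' si) -(nth_map v0 y0) ?E' //.
by rewrite -(size_map (h b)) E'.
Qed.

(** The trace of [first_hit] on the tuple of chosen sets. The last set is left out of the
    distinctness condition because its value closes the cycle. *)
Definition hitting (inc : rel X) j (ys : j.+1.-tuple X) : Prop :=
  uniq (map f (take j ys)) /\
  exists i : 'I_j, let y := tnth ys (widen_ord (leqnSn j) i) in
    f y = f (tnth ys ord_max) /\ inc y (tnth ys ord_max).

Lemma first_hit_in (inc : rel X) j (A : {set j.+1.-tuple X}) :
  (forall ys, ys \in A -> hitting inc ys) ->
  #|A| * #|W| <= #|X| ^ j.+1 * #|[set b | first_hit inc b j]|.
Proof.
move=> HA; apply: leq_trans (hashed_in _) _ => [ys /HA[]//|].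
rewrite leq_mul2l; apply/orP; right; apply: subset_leq_card.
apply/fintype.subsetP => b; rewrite !inE => /HA[U [i /=]].
rewrite !tnth_mktuple /= => -[Ef Ei].
apply/andP; split; last by apply/existsP; exists i; rewrite /hwalk !iterS -!/(hwalk _ _) Ef eqxx.
have -> : mkseq (hwalk b) j.+1 = v0 :: map f (take j (hashed b j)).
  rewrite /mkseq -[iota 0 j.+1]/(0 :: iota 1 j) map_cons; congr cons.
  have y0 := h b v0.
  apply: (@eq_from_nth _ v0) => [|k].
    by rewrite !size_map size_iota size_takel ?size_tuple.
  rewrite size_map size_iota => kj.
  rewrite (nth_map 0) ?size_iota // nth_iota // (nth_map y0) ?size_takel ?size_tuple //.
  by rewrite nth_take // nth_hashed // ltnW.
by rewrite cons_uniq U andbT; apply/mapP => -[x _ /esym/eqP]; exact/negP.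
Qed.

(** A walk has only one first repetition. Thus the counts for different lengths may be added. *)
Lemma first_hit_disjoint (inc : rel X) b j j' :
  first_hit inc b j -> first_hit inc b j' -> j = j'.
Proof.
wlog lt : j j' / j < j' => [H|].
  by case: (ltngtP j j') => // lt H1 H2; [apply: H|apply/esym/H].
move=> /andP[_ /existsP[i /andP[/eqP E _]]] /andP[U _].
have := @nth_uniq _ v0 _ j.+1 i.+1 _ _ U; rewrite !size_mkseq !nth_mkseq; try by have := ltn_ord i; lia.
by rewrite E eqxx eqSS => /(_ _ _)/esym/eqP; have := ltn_ord i; lia.
Qed.

Variables (L : finType) (lev : X -> L) (inc : rel X).
Hypothesis inc_lev : forall x y, lev x = lev y -> x != y -> inc x y.

Lemma many_collisions :
  2 * #|L| * #|X| <= ncollisions f ->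
  #|W| <= #|X| * #|[set b | first_hit inc b 1]|.
Proof.
move=> H.
pose G := [set p : X * X | (f p.1 == f p.2) && inc p.1 p.2].
(* A collision within a level is either a pair in [inc] or on the diagonal. The diagonal has [#|X|]
   elements, which the factor 2 in the hypothesis pays for. *)
have NG : #|L| * #|X| <= #|L| * #|G|.
  have := card_collisions_level f lev; rewrite -ncollisionsE.
  have : #|[set p : X * X | (f p.1 == f p.2) && (lev p.1 == lev p.2)]| <=
      #|G| + #|X|.
    have -> : #|X| = #|[set (x, x) | x : X]|.
      by rewrite card_imset // => x y [].
    apply: leq_trans (leq_card_setU _ _); apply: subset_leq_card.
    apply/fintype.subsetP => -[x y]; rewrite !inE /= => /andP[-> /eqP E] /=.
    case: (eqVneq x y) => [<-|/(inc_lev E)->//].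
    by apply/orP; right; apply/imsetP; exists x.
  by move: H; set a := #|L|; set b := #|X|; set c := #|G|; set d := #|_|; nia.
case: (posnP #|X|) => [X0|x0].
  rewrite X0 mul0n leqn0; apply/eqP/eq_card0 => b.
  by have := card0_eq X0 (h b v0); rewrite !inE.
have GN : #|X| <= #|G|.
  by rewrite -(leq_pmul2l (_ : 0 < #|L|)) //; apply/card_gt0P; exists (lev (enum_val (Ordinal x0))).
pose tup (p : X * X) : 2.-tuple X := [tuple p.1; p.2].
have tup_inj : injective tup by move=> [x y] [x' y'] [-> ->].
have HA ys : ys \in [set tup p | p in G] -> hitting inc ys.
  move=> /imsetP[[x y]]; rewrite inE /= => /andP[/eqP fxy ixy] ->.
  by split=> //; exists ord0; rewrite !(tnth_nth x).
have := first_hit_in HA; rewrite (card_imset _ tup_inj) => B.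
rewrite -(leq_pmul2l x0) mulnA mulnn.
by apply: leq_trans B; rewrite leq_mul2r GN orbT.
Qed.

Variables u v : X.
Hypotheses (uv : f u = f v) (inc_uv : inc u v).

(** The choices of a walk that meets u at position [p.1] and its partner v at the end, with [p.2] at
    the other positions. *)
Definition plant l (p : 'I_l.+1 * l.-tuple X) : seq X :=
  rcons (take p.1 p.2 ++ u :: drop p.1 p.2) v.

Lemma size_plant l p : size (@plant l p) == l.+2.
Proof.
rewrite size_rcons size_cat /= addnS -size_cat cat_take_drop size_tuple //.
Qed.

(** There are l+1 positions for u and at least a quarter of all l-tuples as filling, among N^(l+2)
    tuples of choices: the fraction is at least (l+1)/(4N^2), with N = [#|X|]. *)
Lemma few_collisions l :
  4 * l ^ 2 * ncollisions f <= #|X| ^ 2 ->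
  l.+1 * #|W| <= 4 * #|X| ^ 2 * #|[set b | first_hit inc b l.+1]|.
Proof.
move=> /(ninjective_ge4 u) C.
pose Z := [set z : l.-tuple X | uniq (f u :: map f z)].
pose T (p : 'I_l.+1 * l.-tuple X) : l.+2.-tuple X := Tuple (size_plant p).
pose D := finset.setX [set: 'I_l.+1] Z.
have nthT (p : 'I_l.+1 * l.-tuple X) x : nth x (T p) p.1 = u.
  have lt := ltn_ord p.1; rewrite nth_rcons size_cat /= size_takel ?size_tuple; last by rewrite -ltnS.
  by rewrite addnS ltnS leq_addr nth_cat size_takel ?size_tuple ?ltnn ?subnn // -ltnS.
(* The filling avoids the value f u, hence u itself, so the position of u is recovered as its first
   index. *)
have T_inj : {in D &, injective T}.
  move=> [i z] [i' z']; rewrite !inE /= => /andP[uz Uz] /andP[uz' Uz'].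
  move=> /(congr1 val) /= /rcons_inj [E].
  have nu r : f u \notin map f r -> u \notin r.
    by apply: contra => ur; apply: map_f.
  have I (k : 'I_l.+1) (r : l.-tuple X) : f u \notin map f r ->
      index u (take k r ++ u :: drop k r) = k.
    move=> /nu ur; rewrite index_cat (negbTE (_ : u \notin take k r)).
      by rewrite /= eqxx addn0 size_takel // size_tuple -ltnS.
    by apply: contra ur; apply: mem_take.
  have Ei : i = i' by apply: val_inj; rewrite /= -(I i z) // E I.
  congr pair => //; apply: val_inj => /=.
  move/eqP: E; rewrite -Ei eqseq_cat; last first.
    by rewrite !size_takel ?size_tuple // -ltnS.
  by rewrite eqseq_cons eqxx /= => /andP[/eqP E1 /eqP E2]; rewrite -(cat_take_drop i z) E1 E2 cat_take_drop.
have HA ys : ys \in T @: D -> hitting inc ys.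
  move=> /imsetP[[i z]]; rewrite !inE /= => /andP[uz Uz] ->.
  have E : take l.+1 (T (i, z)) = take i z ++ u :: drop i z.
    rewrite /= /plant -cats1 take_cat size_cat /= addnS -size_cat cat_take_drop size_tuple ltnn.
    by rewrite subnn cats0.
  split.
    rewrite E map_cat /=.
    have P : perm_eq (map f (take i z) ++ f u :: map f (drop i z)) (f u :: map f z).
      by rewrite perm_catC /= perm_cons perm_catC -map_cat cat_take_drop.
    by rewrite (perm_uniq P) /= uz.
  exists i; rewrite !(tnth_nth u) /= -?[plant _]/(val (T (i, z))) (nthT (i, z)) //=.
  have -> : nth u (plant (i, z)) l.+1 = v.
    by rewrite nth_rcons size_cat /= addnS -size_cat cat_take_drop size_tuple ltnn eqxx.
  by [].
have := first_hit_in HA; rewrite (card_in_imset T_inj) cardsX cardsT card_ord -/Z => B.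
have N0 : 0 < #|X| ^ l by rewrite expn_gt0; apply/orP; left; apply/card_gt0P; exists u.
rewrite -(leq_pmul2l N0).
have E : #|X| ^ l * (l.+1 * #|W|) <= 4 * (l.+1 * #|Z| * #|W|).
  have -> : 4 * (l.+1 * #|Z| * #|W|) = 4 * #|Z| * (l.+1 * #|W|) by ring.
  by rewrite leq_mul2r C orbT.
apply: leq_trans E _; rewrite -[l.+2]addn2 expnD in B.
have -> : #|X| ^ l * (4 * #|X| ^ 2 * #|[set b | first_hit inc b l.+1]|) =
  4 * (#|X| ^ l * #|X| ^ 2 * #|[set b | first_hit inc b l.+1]|) by ring.
by rewrite leq_mul2l B orbT.
Qed.

(** With N = [#|X|] and D = [#|L|], few collisions means fewer than 2DN, and 8DJ^2 <= N is what
    [few_collisions] needs for all l < J. Adding (l+1)/(4N^2) over l < J gives J(J+1)/(8N^2), and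
    maximality of J gives N < 8D(J+1)^2 <= 16DJ(J+1); hence 128 = 8 * 16. *)
Lemma first_hit_bound :
  #|W| <= 128 * #|L| * #|X| *
    #|[set b | [exists j : 'I_#|X|.+1, [&& 0 < j, j ^ 2 <= #|X| & first_hit inc b j]]]|.
Proof.
set E := [set b | _].
have N0 : 0 < #|X| by apply/card_gt0P; exists u.
have D0 : 0 < #|L| by apply/card_gt0P; exists (lev u).
have subE j : 0 < j -> j ^ 2 <= #|X| -> [set b | first_hit inc b j] \subset E.
  move=> j0 jN; apply/fintype.subsetP => b; rewrite !inE => hb.
  have lt : j < #|X|.+1 by rewrite ltnS (leq_trans _ jN) // leq_pmulr.
  by apply/existsP; exists (Ordinal lt); rewrite /= j0 jN.
have E1 := subset_leq_card (subE 1 isT N0).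
case: (leqP (2 * #|L| * #|X|) (ncollisions f)) => [/many_collisions H|few].
  apply: leq_trans H _; rewrite leq_mul // leq_pmull //; lia.
have P0 : exists j, 8 * #|L| * j ^ 2 <= #|X| by exists 0; rewrite muln0.
have Pb j : 8 * #|L| * j ^ 2 <= #|X| -> j <= #|X|.
  by move=> H; apply: leq_trans H; case: j => // j; nia.
case: (ex_maxnP P0 Pb) => J HJ maxJ.
have ltJ : #|X| < 8 * #|L| * J.+1 ^ 2.
  by rewrite ltnNge; apply/negP => /maxJ; rewrite ltnn.
(* If J = 0 then N < 8D, and the walk with l = 0, of probability at least 1/(4N^2), already
   suffices. *)
case: (posnP J) => [J0|J0].
  have := @few_collisions 0; rewrite exp0n // muln0 mul0n mul1n => /(_ isT) H.
  apply: leq_trans H _; rewrite J0 in ltJ.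
  move: E1; set e := #|E|; set e1 := #|_|; move: ltJ; rewrite exp1n.
  set N := #|X|; set D := #|L|; set w := #|[set b | first_hit inc b 1]|.
  move=> ltJ E1; apply: leq_trans (_ : 4 * (N * (8 * D)) * e <= _); last by nia.
  by apply: leq_mul => //; rewrite leq_mul2l /= leq_mul2l ltnW ?orbT // -[8 * D]muln1.
have Hl (l : 'I_J) : l.+1 * #|W| <= 4 * #|X| ^ 2 * #|[set b | first_hit inc b l.+1]|.
  apply: few_collisions; apply: leq_trans (_ : 4 * J ^ 2 * (2 * #|L| * #|X|) <= _).
    by rewrite leq_mul // ?leq_mul2l ?leq_sqr ltnW.
  have -> : 4 * J ^ 2 * (2 * #|L| * #|X|) = 8 * #|L| * J ^ 2 * #|X| by ring.
  by rewrite -mulnn leq_mul2r HJ orbT.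
have SE : \sum_(l < J) #|[set b | first_hit inc b l.+1]| <= #|E|.
  have dis (l l' : 'I_J) : l != l' ->
      [disjoint [set b | first_hit inc b l.+1] & [set b | first_hit inc b l'.+1]].
    move=> ne; apply/pred0P => b /=; rewrite !inE; apply/negP => /andP[h1 h2].
    by case/eqP: ne; apply: val_inj; have [] := first_hit_disjoint h1 h2.
  under eq_bigr => l _ do rewrite -sum1_card.
  rewrite -(@partition_disjoint_bigcup _ _ _ _ addn _ (fun=> 1) dis).
  rewrite sum1_card subset_leq_card //; apply/finset.bigcupsP => l _; apply: subE => //.
  by apply: leq_trans HJ; have := ltn_ord l; nia.
have G : J * J.+1 * #|W| <= 8 * #|X| ^ 2 * #|E|.
  have : \sum_(l < J) l.+1 * #|W| <= 4 * #|X| ^ 2 * #|E|.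
    apply: leq_trans (leq_mul (leqnn _) SE); rewrite big_distrr /=.
    by apply: leq_sum => l _; apply: Hl.
  rewrite -big_distrl /=.
  have -> : \sum_(l < J) l.+1 = 'C(J.+1, 2).
    by rewrite -bin2_sum big_nat_recl // add0n big_mkord.
  have := mul_bin_diag J.+1 1; rewrite bin1 /=; nia.
have F : #|X| <= 16 * #|L| * (J * J.+1).
  by apply: leq_trans (ltnW ltJ) _; nia.
rewrite -(leq_pmul2l N0).
apply: leq_trans (_ : 16 * #|L| * (J * J.+1 * #|W|) <= _).
  by rewrite mulnA leq_mul2r F orbT.
have -> : #|X| * (128 * #|L| * #|X| * #|E|) = 16 * #|L| * (8 * #|X| ^ 2 * #|E|) by ring.
by rewrite leq_mul2l G orbT.
Qed.
End HashWalk.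

Import Order.TTheory GRing.Theory Num.Theory.
Local Open Scope ring_scope.

(** * Collisions of subset sums *)

(** Flipping the bits at the positions where two prescriptions differ maps the strings of one
    injectively into those of the other, so all prescriptions have equally many strings. *)
Lemma card_prescribed (B : nat) (I : finType) (pos : I -> 'I_B)
    (val : I -> bool) : injective pos ->
  (#|[set b : B.-tuple bool | [forall i, tnth b (pos i) == val i]]| * 2 ^ #|I|
     = 2 ^ B)%N.
Proof.
move=> pos_inj.
pose c (x : {ffun I -> bool}) : nat :=
  #|[set b : B.-tuple bool | [ffun i => tnth b (pos i)] == x]|.
have le x y : (c x <= c y)%N.
  pose e k := [exists i, (pos i == k) && (x i (+) y i)].
  have eP i : e (pos i) = x i (+) y i.
    apply/existsP/idP => [[i' /andP[/eqP/pos_inj ->]]//|xy].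
    by exists i; rewrite eqxx.
  pose t (b : B.-tuple bool) := [tuple tnth b k (+) e k | k < B].
  have t_inj : injective t.
    move=> b b' E; apply: eq_from_tnth => k.
    by move/(congr1 (fun z => tnth z k)): E; rewrite !tnth_mktuple => /addIb.
  rewrite /c -(card_imset _ t_inj); apply: subset_leq_card.
  apply/fintype.subsetP => _ /imsetP[b + ->]; rewrite !inE => /eqP E.
  apply/eqP/ffunP => i; rewrite ffunE tnth_mktuple eP -E ffunE.
  by rewrite addbA addbb.
have S : (\sum_x c x = 2 ^ B)%N.
  have -> : (2 ^ B = #|{: B.-tuple bool}|)%N by rewrite card_tuple card_bool.
  rewrite -sum1_card (partition_big (fun b : B.-tuple bool => [ffun i => tnth b (pos i)]) predT) //=.
  by apply: eq_bigr => x _; rewrite /c cardsE -sum1_card.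
have -> : [set b : B.-tuple bool | [forall i, tnth b (pos i) == val i]] =
    [set b : B.-tuple bool | [ffun i => tnth b (pos i)] == [ffun i => val i]].
  apply/setP => b; rewrite !inE; apply/forallP/eqP => [H|H i].
    by apply/ffunP => i; rewrite !ffunE; apply/eqP.
  by move/ffunP/(_ i): H; rewrite !ffunE => ->.
rewrite -/(c _) -S (eq_bigr (fun=> c [ffun i => val i])); last first.
  by move=> x _; apply/eqP; rewrite eqn_leq !le.
by rewrite sum_nat_const card_ffun card_bool mulnC.
Qed.

(** The successor makes it strictly larger than every absolute subset sum, so that the radius itself
    is free to be the start of the walk. *)
Definition radius (s : seq int) : nat := (\sum_(z <- s) `|z|%N).+1.

(** The number of integers of absolute value at most the radius: one row of the block per index, one
    bit of the row per possible vertex. *)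
Definition stride (s : seq int) : nat := (radius s + radius s).+1.

Definition block (s : seq int) : nat := (size s * stride s)%N.

Section Trial.
Variable s : seq int.
Local Notation n := (size s).

Definition subsum (A : {set 'I_n}) : int := \sum_(j in A) s`_j.

Definition incomparable (A B : {set 'I_n}) : bool :=
  ~~ (A \subset B) && ~~ (B \subset A).

Lemma card_sets : #|{set 'I_n}| = (2 ^ n)%N.
Proof. by rewrite -cardsT -powersetT card_powerset cardsT card_ord. Qed.

Lemma subsum_lt A : (`|subsum A| < radius s)%N.
Proof.
rewrite ltnS; apply: (@leq_trans (\sum_(j in A) `|nth 0%R s j|)%N).
  rewrite /subsum; elim/big_rec2: _ => // j a b _; lia.
rewrite (big_nth 0) big_mkord big_mkcond /=; apply: leq_sum => j _.
by case: ifP.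
Qed.

(* Adding the radius shifts the values [v] of a walk into [0, stride), so that
   distinct pairs [(v, j)] read distinct bits of the block. *)
Definition hset (b : seq bool) (v : int) : {set 'I_n} :=
  [set j : 'I_n | nth false b (`|((radius s)%:Z + v)%R| + j * stride s)%N].

Definition nxt (b : seq bool) (v : int) : int := subsum (hset b v).

Definition good (b : seq bool) (v w : int) : bool :=
  incomparable (hset b v) (hset b w) && (nxt b v == nxt b w).

(* Not a subset sum, so the walk never returns to it. *)
Definition start : int := (radius s)%:Z.

(* Floyd's cycle finding, cut off after [t] steps. *)
Definition trial (t : nat) (b : seq bool) : bool :=
  has (fun i => good b (iter i (nxt b) start)
                       (iter i (nxt b) (meet (nxt b) start t))) (iota 0 t).

Lemma trial_sound t b : trial t b ->
  exists A B, incomparable A B /\ subsum A = subsum B.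
Proof.
move=> /hasP[i _ /andP[I /eqP E]].
by exists (hset b (iter i (nxt b) start)),
  (hset b (iter i (nxt b) (meet (nxt b) start t))).
Qed.

(** Shifted vertices lie in [0, stride), so division by the stride recovers index and vertex from an
    address: the bits read are distinct and [card_prescribed] applies. *)
Lemma hset_uniform (ws : seq int) (ys : seq {set 'I_n}) :
  uniq ws -> {in ws, forall w, w = start \/ exists A, w = subsum A} ->
  size ys = size ws ->
  (#|[set b : (block s).-tuple bool | map (hset b) ws == ys]| *
     #|{set 'I_n}| ^ size ws = #|{: (block s).-tuple bool}|)%N.
Proof.
move=> U H sz.
have R w : w \in ws -> (`|((radius s)%:Z + w)%R| < stride s)%N.
  by rewrite /stride => /H[->|[A ->]]; rewrite /start; have := subsum_lt; [lia|move/(_ A); lia].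
have R' w : w \in ws -> 0 <= (radius s)%:Z + w.
  by move=> /H[->|[A ->]]; rewrite /start; have := subsum_lt; [lia|move/(_ A); lia].
pose p (ij : 'I_(size ws) * 'I_n) : nat :=
  (`|((radius s)%:Z + nth 0 ws ij.1)%R| + ij.2 * stride s)%N.
have memw (i : 'I_(size ws)) : ws`_i \in ws by apply: mem_nth.
have pB ij : (p ij < block s)%N.
  rewrite /p /block; have := R _ (memw ij.1); have := ltn_ord ij.2.
  set a := `|_|%N; set j : nat := ij.2; set S := stride s => jn aS.
  apply: leq_trans (_ : j.+1 * S <= _)%N; first by rewrite mulSn; lia.
  by rewrite leq_mul2r jn orbT.
pose pos ij := Ordinal (pB ij).
have pos_inj : injective pos.
  move=> [i j] [i' j'] /(congr1 val); rewrite /= /p /=.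
  have a1 := R _ (memw i); have a2 := R _ (memw i').
  have b1 := R' _ (memw i); have b2 := R' _ (memw i').
  move=> E; have Ej : j = j' :> nat.
    have := congr1 (fun x => x %/ stride s)%N E.
    by rewrite /= addnC divnMDl // [in RHS]addnC divnMDl // !divn_small // !addn0.
  have aux (x y r : int) : 0 <= r + x -> 0 <= r + y -> absz (r + x) = absz (r + y) -> x = y by lia.
  have Ei : ws`_i = ws`_i' by move: E; rewrite Ej => /addIn; exact: aux b1 b2.
  congr pair; apply: val_inj => //=; apply/eqP.
  by rewrite -(nth_uniq 0 _ _ U) ?Ei // ltn_ord.
have := @card_prescribed (block s) _ pos (fun ij => ij.2 \in nth finset.set0 ys ij.1) pos_inj.
rewrite card_prod !card_ord card_tuple card_bool => <-.
rewrite card_sets.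
rewrite -expnM mulnC [in RHS]mulnC [(n * _)%N]mulnC; congr (_ * _)%N; apply: eq_card => b.
rewrite !inE; apply/eqP/forallP => [<- [i j]|E].
  by rewrite (nth_map 0) //= inE (tnth_nth false).
apply: (@eq_from_nth _ finset.set0) => [|i]; first by rewrite size_map.
rewrite size_map => lt; rewrite (nth_map 0) //; apply/setP => j; rewrite inE.
by have /eqP := E (Ordinal lt, j); rewrite (tnth_nth false).
Qed.

Definition level (A : {set 'I_n}) : 'I_n.+1 := inord #|A|.

Lemma incomparable_level A B :
  level A = level B -> A != B -> incomparable A B.
Proof.
have leA (C : {set 'I_n}) : (#|C| < n.+1)%N.
  by rewrite ltnS -[X in (_ <= X)%N]card_ord max_card.
move=> /(congr1 val); rewrite /= !inordK // => E ne.
rewrite /incomparable; apply/andP; split; apply: contra ne => sub.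
  by rewrite eqEcard sub E /=.
by rewrite eq_sym eqEcard sub E /=.
Qed.

(** Under the event of [first_hit_bound], after i parallel steps the walkers stand at times i and j
    by [floyd], and the check made there succeeds. *)
Lemma trial_complete t A B : (forall j, (j ^ 2 <= 2 ^ n)%N -> (j <= t)%N) ->
  incomparable A B -> subsum A = subsum B ->
  (2 ^ block s <= 128 * n.+1 * 2 ^ n *
     #|[set b : (block s).-tuple bool | trial t b]|)%N.
Proof.
move=> tP incAB eqAB.
have v0P C : subsum C != start.
  by apply/eqP; have := subsum_lt C; rewrite /start; lia.
have := @first_hit_bound _ _ _ subsum start (fun b : (block s).-tuple bool => hset b)
  v0P hset_uniform _ level incomparable incomparable_level A B eqAB incAB.
rewrite card_sets.
rewrite card_tuple card_bool card_ord => H; apply: leq_trans H _.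
rewrite leq_mul2l; apply/orP; right; apply: subset_leq_card.
apply/fintype.subsetP => b; rewrite !inE => /existsP[j /and3P[_ jN]].
move=> /andP[U /existsP[i /andP[/eqP E I]]].
have jt := tP _ jN.
apply/hasP; exists (val i); first by rewrite mem_iota /=; apply: leq_trans jt; rewrite ltn_ord.
rewrite (floyd (ltn_ord i) U E jt).
by apply/andP; split=> //; rewrite eq_sym; apply/eqP; move: E; rewrite /hwalk !iterS.
Qed.

End Trial.

(** * Independent repetition, and the link with sets of integers *)

Lemma big_tcat (B d : nat) (F : (B + d).-tuple bool -> nat) :
  (\sum_z F z = \sum_(b : B.-tuple bool) \sum_(r : d.-tuple bool) F [tuple of b ++ r])%N.
Proof.
rewrite pair_big /=.
pose g (p : B.-tuple bool * d.-tuple bool) := [tuple of p.1 ++ p.2].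
rewrite (reindex g) //=; apply: onW_bij; apply: inj_card_bij.
  move=> [x y] [x' y'] /(congr1 val)/eqP; rewrite /= eqseq_cat ?size_tuple //.
  by move=> /andP[/eqP/val_inj -> /eqP/val_inj ->].
by rewrite card_prod !card_tuple expnD.
Qed.

Definition solve (s : seq int) (K t : nat) (r : seq bool) : bool :=
  has (fun k => trial s t (take (block s) (drop (k * block s) r))) (iota 0 K).

(** Trials read consecutive disjoint blocks, so the failure counts multiply; the d trailing bits are
    free. *)
Lemma card_all_fail (P : pred (seq bool)) (B K d m : nat) : (m = K * B + d)%N ->
  (#|[set r : m.-tuple bool |
       ~~ has (fun k => P (take B (drop (k * B) r))) (iota 0 K)]| =
   #|[set b : B.-tuple bool | ~~ P b]| ^ K * 2 ^ d)%N.
Proof.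
elim: K m => [|K IH] m.
  rewrite mul0n add0n => ->; rewrite mul1n cardsE.
  by rewrite -[LHS]/(#|predT : pred (d.-tuple bool)|) card_tuple card_bool.
rewrite mulSn -addnA => ->; set F := #|[set b : B.-tuple bool | ~~ P b]|.
rewrite card_set_sum big_tcat expnS -mulnA -(IH _ erefl) /F [X in _ = (X * _)%N]card_set_sum big_distrl /=.
apply: eq_bigr => b _; rewrite card_set_sum big_distrr /=; apply: eq_bigr => r _.
rewrite mul0n drop0 take_size_cat ?size_tuple // negb_or mulnb.
congr (nat_of_bool (_ && ~~ _)).
rewrite -[1%N]addn0 iotaDl has_map; apply: eq_has => k /=.
by rewrite mulSn drop_cat size_tuple ltnNge leq_addr /= addKn.
Qed.

(** For H > 0 this is (1 - 1/H)^K (1 + K/H) <= 1 without division. *)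
Lemma bernoulli_nat (H K : nat) : (H.-1 ^ K * (H + K) <= H ^ K * H)%N.
Proof.
elim: K => [|K IH]; first by rewrite addn0.
case: H IH => [|H] IH; first by rewrite /= exp0n.
rewrite !expnS /=; apply: leq_trans (_ : H.+1 * (H ^ K * (H.+1 + K)) <= _)%N.
  rewrite /= in IH *; set a := (H ^ K)%N; nia.
by rewrite -mulnA leq_mul2l IH.
Qed.

(** For K >= 2H the factor 1 + K/H is at least 3, so a failure fraction a/b <= 1 - 1/H drops to at
    most 1/3 after K trials. *)
Lemma amplify (a b H K : nat) : (0 < H)%N -> (2 * H <= K)%N ->
  (a * H <= H.-1 * b)%N -> (3 * a ^ K <= b ^ K)%N.
Proof.
move=> H0 HK ab.
have abK : (a ^ K * H ^ K <= H.-1 ^ K * b ^ K)%N by rewrite -!expnMn leq_exp2r //; lia.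
have HK0 : (0 < H ^ K)%N by rewrite expn_gt0 H0.
rewrite -(leq_pmul2l H0) -(leq_pmul2l HK0).
have B := bernoulli_nat H K.
move: abK B HK0; set x := (a ^ K)%N; set y := (H ^ K)%N; set z := (H.-1 ^ K)%N.
set w := (b ^ K)%N => B1 B2 y0.
apply: (@leq_trans (x * y * (H + K))%N).
  have -> : (y * (H * (3 * x)) = x * y * (3 * H))%N by ring.
  by rewrite leq_mul2l; apply/orP; right; lia.
apply: (@leq_trans (z * w * (H + K))%N); first by rewrite leq_mul2r B1 orbT.
have -> : (z * w * (H + K) = z * (H + K) * w)%N by ring.
by rewrite mulnA leq_mul2r B2 orbT.
Qed.

Lemma sum_fset_subsum (s : seq int) (A : {fset int}) : uniq s ->
  (A `<=` [fset x in s])%fset ->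
  \sum_(a <- A) a = subsum [set j : 'I_(size s) | s`_j \in A].
Proof.
move=> U sub.
have P : perm_eq A [seq z <- s | z \in A].
  apply: uniq_perm; [exact: fset_uniq|exact: filter_uniq|].
  move=> z; rewrite mem_filter andb_idr // => /(fsubsetP sub).
  by rewrite !inE.
rewrite (perm_big _ P) big_filter (big_nth 0) big_mkord.
by apply: eq_bigl => j; rewrite inE.
Qed.

(** Disjoint nonempty sets are never nested. Conversely, removing the common part of two
    incomparable sets leaves disjoint nonempty sets and subtracts the same amount from both sums. *)
Lemma equal_subset_sumP (s : seq int) : uniq s ->
  equal_subset_sum [fset x in s]%fset <->
  exists A B : {set 'I_(size s)}, incomparable A B /\ subsum A = subsum B.
Proof.
move=> U; split=> [[A [B [sA sB dAB [nA nB] E]]]|[A [B [/andP[nAB nBA] E]]]].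
  rewrite (sum_fset_subsum U sA) (sum_fset_subsum U sB) in E.
  exists [set j : 'I_(size s) | s`_j \in A], [set j : 'I_(size s) | s`_j \in B].
  split=> //.
  have key (C D : {fset int}) : (C `<=` [fset x in s])%fset -> C != fset0 ->
      [disjoint C & D]%fset ->
      ~~ ([set j : 'I_(size s) | s`_j \in C] \subset [set j : 'I_(size s) | s`_j \in D]).
    move=> sC /fset0Pn[c cC] dis; apply/negP => /fintype.subsetP sub.
    have cs : c \in s by have := fsubsetP sC _ cC; rewrite !inE.
    have lt : (index c s < size s)%N by rewrite index_mem.
    have := sub (Ordinal lt); rewrite !inE /= nth_index // => /(_ cC) cD.
    by move/fdisjointP: dis => /(_ c cC); rewrite cD.
  by rewrite /incomparable !key // fdisjoint_sym.
pose F (C : {set 'I_(size s)}) : {fset int} := [fset z in [seq s`_j | j : 'I_(size s) <- enum C]]%fset.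
have memF C (j : 'I_(size s)) : (s`_j \in F C) = (j \in C).
  rewrite !inE; apply/mapP/idP => [[i iC Eij]|jC]; last by exists j => //; rewrite mem_enum.
  suff -> : j = i by rewrite mem_enum in iC.
  by apply: val_inj; apply/eqP; rewrite -(nth_uniq 0 (ltn_ord j) (ltn_ord i) U) Eij.
have subF C : (F C `<=` [fset x in s])%fset.
  by apply/fsubsetP => z; rewrite !inE => /mapP[j _ ->]; apply: mem_nth.
have sumF C : \sum_(a <- F C) a = subsum C.
  by rewrite (sum_fset_subsum U (subF C)); apply: eq_bigl => j; rewrite inE memF.
exists (F (A :\: B)), (F (B :\: A)); split=> //.
- apply/fdisjointP => z; rewrite inE => /mapP[j jA ->]; rewrite memF.
  by move: jA; rewrite mem_enum !inE => /andP[/negbTE -> _]; rewrite andbF.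
- have key (C D : {set 'I_(size s)}) : ~~ (C \subset D) -> F (C :\: D) != fset0.
    move=> /subsetPn[j jC jD]; apply/fset0Pn; exists s`_j.
    by rewrite memF !inE jC jD.
  by split; apply: key.
- rewrite !sumF; move: E; rewrite /subsum (big_setID B) /= [X in _ = X](big_setID A) /=.
  by rewrite finset.setIC => /addrI.
Qed.

Lemma solve_sound (s : seq int) K t r : solve s K t r ->
  exists A B : {set 'I_(size s)}, incomparable A B /\ subsum A = subsum B.
Proof. by move=> /hasP[k _ /trial_sound]. Qed.

(* At least [2 * 128 (n+1) 2^n], twice the inverse of the success probability of
   one trial. *)
Definition trials (n : nat) : nat := (512 * n * 2 ^ n)%N.

Lemma solve_complete (s : seq int) (t m : nat) (A B : {set 'I_(size s)}) :
  (0 < size s)%N -> (forall j, (j ^ 2 <= 2 ^ size s)%N -> (j <= t)%N) ->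
  (trials (size s) * block s <= m)%N ->
  incomparable A B -> subsum A = subsum B ->
  2 / 3 <= prob (fun r : m.-tuple bool => solve s (trials (size s)) t r).
Proof.
set n := size s; set K := trials n; set L := block s => n0 tP mK iAB eAB.
have H1 := trial_complete tP iAB eAB.
rewrite -/n -/L in H1; set H := (128 * n.+1 * 2 ^ n)%N in H1.
set a := #|[set b : L.-tuple bool | ~~ trial s t b]|.
have aE : (#|[set b : L.-tuple bool | trial s t b]| + a = 2 ^ L)%N.
  rewrite -[RHS](_ : #|{: L.-tuple bool}| = _); last by rewrite card_tuple card_bool.
  rewrite -(cardsC [set b : L.-tuple bool | trial s t b]); congr (_ + _)%N.
  by apply: eq_card => b; rewrite !inE.
have H0 : (0 < H)%N by rewrite !muln_gt0 /= expn_gt0.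
have HK : (2 * H <= K)%N.
  by rewrite /H /K /trials; set N := (2 ^ n)%N; nia.
(* By [H1] at least a fraction 1/H of the blocks succeeds. *)
have aH : (a * H <= H.-1 * 2 ^ L)%N by nia.
have F3 := amplify H0 HK aH.
have F := @card_all_fail (trial s t) L K (m - K * L) m (esym (subnKC mK)).
rewrite -/a in F.
rewrite /prob card_tuple card_bool.
set g := #|[set r : m.-tuple bool | solve s K t r]|.
have gE : (g + a ^ K * 2 ^ (m - K * L) = 2 ^ m)%N.
  rewrite -F -[RHS](_ : #|{: m.-tuple bool}| = _); last by rewrite card_tuple card_bool.
  rewrite -(cardsC [set r : m.-tuple bool | solve s K t r]); congr (_ + _)%N.
  by apply: eq_card => b; rewrite !inE.
have F4 : (3 * (a ^ K * 2 ^ (m - K * L)) <= 2 ^ m)%N.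
  rewrite -[X in (_ <= _ ^ X)%N](subnKC mK) expnD mulnA leq_mul2r.
  by rewrite [X in (_ <= 2 ^ X)%N]mulnC expnM F3 orbT.
have G : (2 * 2 ^ m <= 3 * g)%N by lia.
rewrite ler_pdivlMr ?ltr0n ?expn_gt0 //.
rewrite mulrAC ler_pdivrMr ?ltr0n // -!natrM ler_nat mulnC.
by rewrite [X in (_ <= X)%N]mulnC mulnC.
Qed.

(** * Structured programs for the random access machine *)

Definition memory := nat -> int.

Definition upd (g : memory) (a : nat) (z : int) : memory :=
  fun b => if b == a then z else g b.

Lemma upd_nth (m : seq int) (a : nat) (z : int) :
  nth 0 (set_nth 0 m a z) = upd (nth 0 m) a z.
Proof. by apply/funext => b; rewrite nth_set_nth. Qed.

Inductive cmd : Type :=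
  | Op of instr
  | Seq of cmd & cmd
  | When of nat & cmd
  | While of nat & cmd.

Fixpoint len (c : cmd) : nat :=
  match c with
  | Op _ => 1
  | Seq c1 c2 => len c1 + len c2
  | When _ c1 => (len c1).+2
  | While _ c1 => (len c1).+3
  end.

(** Jump targets are absolute, hence the offset o. The instruction after a conditional jump is the
    exit taken when the test fails. *)
Fixpoint compile (o : nat) (c : cmd) : program :=
  match c with
  | Op i => [:: i]
  | Seq c1 c2 => compile o c1 ++ compile (o + len c1) c2
  | When a c1 =>
      [:: IJumpPos a o.+2; IJump (o.+2 + len c1)] ++ compile o.+2 c1
  | While a c1 =>
      [:: IJumpPos a o.+2; IJump (o.+3 + len c1)] ++ compile o.+2 c1 ++
      [:: IJump o]
  end.

Lemma size_compile c o : size (compile o c) = len c.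
Proof.
elim: c o => [i|c1 IH1 c2 IH2|a c1 IH|a c1 IH] o //=.
- by rewrite size_cat IH1 IH2.
- by rewrite IH.
- by rewrite size_cat IH addn1.
Qed.

(* Where the instruction writes and what; meaningless for the two jumps. *)
Definition effect (rnd : seq bool) (i : instr) (g : memory) : nat * int :=
  match i with
  | IConst d z => (d, z)
  | IAdd d a b => (d, g a + g b)
  | ISub d a b => (d, g a - g b)
  | ILoad d a => (d, g `|g a|%N)
  | IStore d a => (`|g d|%N, g a)
  | IRand d a => (d, (nat_of_bool (nth false rnd `|g a|%N))%:Z)
  | IJump _ | IJumpPos _ _ => (0%N, 0)
  end.

Definition is_jump (i : instr) : bool :=
  match i with IJump _ | IJumpPos _ _ => true | _ => false end.

(** Number and magnitude of the cells together bound the space. They are followed through every step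
    because space is charged at all times. *)
Definition fits (A M : nat) (m : seq int) : Prop :=
  (size m <= A)%N /\ forall a, (`|nth 0%R m a| <= M)%N.

Lemma fits_set (A M : nat) (m : seq int) (a : nat) (z : int) :
  fits A M m -> (a < A)%N -> (`|z| <= M)%N -> fits A M (set_nth 0 m a z).
Proof.
move=> [sm vm] aA zM; split; first by rewrite size_set_nth geq_max aA.
by move=> b; rewrite nth_set_nth /=; case: eqP.
Qed.

(* Total correctness within [t] steps; every configuration on the way fits into
   [A] cells of absolute value at most [M]. *)
Definition wp (rnd : seq bool) (A M : nat) (c : cmd) (t : nat)
    (Q : memory -> Prop) (g : memory) : Prop :=
  forall (P1 P2 : program) (m : seq int), nth 0 m = g -> fits A M m ->
  let P := P1 ++ compile (size P1) c ++ P2 in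
  exists t' m', [/\ (t' <= t)%N,
    iter t' (step P rnd) (State (size P1) m) = State (size P1 + len c) m',
    forall k, (k <= t')%N ->
      fits A M (cells (iter k (step P rnd) (State (size P1) m)))
    & Q (nth 0 m')].

Section Rules.
Variables (rnd : seq bool) (A M : nat).
Local Notation wp := (wp rnd A M).

Lemma wp_le c t t' Q g : wp c t Q g -> (t <= t')%N -> wp c t' Q g.
Proof.
move=> H le P1 P2 m mg fm P.
have [k [m' [H1 H2 H3 H4]]] := H P1 P2 m mg fm.
by exists k, m'; split=> //; apply: leq_trans le.
Qed.

Lemma wp_mono c t (Q Q' : memory -> Prop) g :
  wp c t Q g -> (forall g', Q g' -> Q' g') -> wp c t Q' g.
Proof.
move=> H sub P1 P2 m mg fm P.
have [k [m' [H1 H2 H3 H4]]] := H P1 P2 m mg fm.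
by exists k, m'; split=> //; apply: sub.
Qed.

Lemma onth_mid (P1 P2 : program) i : onth (P1 ++ i :: P2) (size P1) = Some i.
Proof. by elim: P1. Qed.

Lemma step_mid (P1 P2 : program) i k m : size P1 = k ->
  step (P1 ++ i :: P2) rnd (State k m) = exec rnd i (State k m).
Proof. by move=> <-; rewrite /step onth_mid. Qed.

Lemma wp_op i (Q : memory -> Prop) g : ~~ is_jump i ->
  ((effect rnd i g).1 < A)%N -> (`|(effect rnd i g).2| <= M)%N ->
  Q (upd g (effect rnd i g).1 (effect rnd i g).2) -> wp (Op i) 1 Q g.
Proof.
move=> ji aA zM q P1 P2 m mg fm P.
set e := effect rnd i g.
have E : step P rnd (State (size P1) m) =
  State (size P1).+1 (set_nth 0 m e.1 e.2).
  by rewrite /step /= onth_mid /e -mg; case: (i) ji.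
have fm' := fits_set fm aA zM.
exists 1%N, (set_nth 0 m e.1 e.2); split=> //.
- by rewrite /= E addn1.
- by case=> [|[|k]] //= _; rewrite E.
- by rewrite upd_nth mg.
Qed.

Lemma wp_seq c1 c2 t1 t2 Q g :
  wp c1 t1 (wp c2 t2 Q) g -> wp (Seq c1 c2) (t1 + t2) Q g.
Proof.
move=> H P1 P2 m mg fm P.
have [k1 [m1 [L1 E1 F1 H1]]] := H P1 (compile (size P1 + len c1) c2 ++ P2) m mg fm.
have fm1 : fits A M m1 by have := F1 k1 (leqnn _); rewrite E1.
have [k2 [m2 [L2 E2 F2 Q2]]] :=
  H1 (P1 ++ compile (size P1) c1) P2 m1 erefl fm1.
have EP1 : P1 ++ compile (size P1) c1 ++ compile (size P1 + len c1) c2 ++ P2 = P.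
  by rewrite /P /= !catA.
have EP2 : (P1 ++ compile (size P1) c1) ++
    compile (size (P1 ++ compile (size P1) c1)) c2 ++ P2 = P.
  by rewrite /P /= size_cat size_compile !catA.
rewrite EP1 in E1 F1; rewrite EP2 size_cat size_compile in E2 F2.
exists (k2 + k1)%N, m2; split=> //.
- by rewrite addnC leq_add.
- by rewrite iterD E1 E2 /= addnA.
- move=> k kle; case: (leqP k k1) => [/F1//|lt].
  rewrite -(subnK (ltnW lt)) iterD E1; apply: F2; lia.
Qed.

Lemma wp_when a c t Q g :
  (0 < g a -> wp c t Q g) -> (~~ (0 < g a) -> Q g) ->
  wp (When a c) (t + 2) Q g.
Proof.
move=> H1 H2 P1 P2 m mg fm P.
have E1 : step P rnd (State (size P1) m) =
    State (if 0 < g a then (size P1).+2 else (size P1).+1) m.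
  by rewrite /step /= onth_mid /= -mg.
case: ifP E1 => [pos|/negbT npos] E1.
  have EP : P = (P1 ++ [:: IJumpPos a (size P1).+2; IJump ((size P1).+2 + len c)]) ++
     compile (size (P1 ++ [:: IJumpPos a (size P1).+2; IJump ((size P1).+2 + len c)])) c
     ++ P2.
    by rewrite /P size_cat /= addn2 -!catA.
  have [k [m' [L E F q]]] := H1 pos (P1 ++ [:: IJumpPos a (size P1).+2;
    IJump ((size P1).+2 + len c)]) P2 m mg fm.
  rewrite -EP size_cat /= addn2 in E F.
  exists k.+1, m'; split=> //; first lia.
  - by rewrite iterSr E1 E; congr State => /=; lia.
  - by case=> [|k'] //= /F; rewrite -iterS iterSr E1.
have E2 : step P rnd (State (size P1).+1 m) = State ((size P1).+2 + len c) m.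
  have -> : P = (P1 ++ [:: IJumpPos a (size P1).+2]) ++
     IJump ((size P1).+2 + len c) :: compile (size P1).+2 c ++ P2.
    by rewrite /P -!catA.
  by apply: step_mid; rewrite size_cat addn1.
exists 2%N, m; split=> //; first lia.
- by rewrite /= E1 E2; congr State => /=; lia.
- by case=> [|[|[|k]]] //= _; rewrite E1 ?E2.
- by rewrite mg; apply: H2.
Qed.

(** The number k of rounds is known beforehand, so the round index replaces a variant. Each round
    pays for the test and the jump back, the exit for the failing test and the jump out. *)
Lemma wp_while a c t k (I : nat -> memory -> Prop) Q g :
  I 0%N g ->
  (forall i g', (i < k)%N -> I i g' -> 0 < g' a /\ wp c t (I i.+1) g') ->
  (forall g', I k g' -> ~~ (0 < g' a) /\ Q g') ->
  wp (While a c) (k * (t + 2) + 2) Q g.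
Proof.
move=> I0 IS IQ.
suff: forall d i g', (i + d = k)%N -> I i g' ->
    wp (While a c) (d * (t + 2) + 2) Q g' by move/(_ k 0%N g); apply.
elim=> [|d IH] i g' ik Ii P1 P2 m mg fm P.
  rewrite addn0 in ik; rewrite ik in Ii; have [npos q] := IQ _ Ii.
  have E1 : step P rnd (State (size P1) m) = State (size P1).+1 m.
    by rewrite /step /= onth_mid /= /peek /= mg (negbTE npos).
  have E2 : step P rnd (State (size P1).+1 m) = State ((size P1).+3 + len c) m.
    have -> : P = (P1 ++ [:: IJumpPos a (size P1).+2]) ++
       IJump ((size P1).+3 + len c) :: compile (size P1).+2 c ++ [:: IJump (size P1)] ++ P2.
      by rewrite /P /= -!catA /=.
    by apply: step_mid; rewrite size_cat addn1.
  exists 2%N, m; split=> //.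
  - by rewrite /= E1 E2; congr State => /=; lia.
  - by case=> [|[|[|k']]] //= _; rewrite E1 ?E2.
  - by rewrite mg.
have [pos Hc] := IS i g' ltac:(lia) Ii.
have E1 : step P rnd (State (size P1) m) = State (size P1).+2 m.
  by rewrite /step /= onth_mid /= /peek /= mg pos.
have [k1 [m1 [L1 F1 G1 Q1]]] := Hc (P1 ++ [:: IJumpPos a (size P1).+2;
    IJump ((size P1).+3 + len c)]) ([:: IJump (size P1)] ++ P2) m mg fm.
have EP : (P1 ++ [:: IJumpPos a (size P1).+2; IJump ((size P1).+3 + len c)]) ++
     compile (size (P1 ++ [:: IJumpPos a (size P1).+2;
       IJump ((size P1).+3 + len c)])) c ++ [:: IJump (size P1)] ++ P2 = P.
  by rewrite /P size_cat /= addn2 -!catA.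
rewrite EP size_cat /= addn2 in F1 G1.
have fm1 : fits A M m1 by have := G1 k1 (leqnn _); rewrite F1.
have E3 : step P rnd (State ((size P1).+2 + len c) m1) = State (size P1) m1.
  have -> : P = (P1 ++ [:: IJumpPos a (size P1).+2; IJump ((size P1).+3 + len c)]
     ++ compile (size P1).+2 c) ++ IJump (size P1) :: P2.
    by rewrite /P /= -?catA /= -?catA.
  have sz : size (P1 ++ [:: IJumpPos a (size P1).+2; IJump ((size P1).+3 + len c)]
     ++ compile (size P1).+2 c) = ((size P1).+2 + len c)%N.
    by rewrite !size_cat size_compile /=; lia.
  exact: step_mid.
have [k2 [m2 [L2 F2 G2 Q2]]] := IH i.+1 (nth 0 m1) ltac:(lia) Q1 P1 P2 m1 erefl fm1.
have EI : iter k1.+2 (step P rnd) (State (size P1) m) = State (size P1) m1.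
  by rewrite -addn1 iterD /= E1 F1 E3.
exists (k2 + k1.+2)%N, m2; split=> //.
- by rewrite mulSn; lia.
- by rewrite iterD EI F2.
- move=> k' k'le; case: (leqP k' k1.+1) => [|lt].
    by case: k' {k'le} => [|k'] // /G1; rewrite iterSr E1.
  by rewrite -(subnK lt) iterD EI; apply: G2; lia.
Qed.

End Rules.

(** * The program *)

Arguments upd g a z b /.

Notation "c1 ;; c2" := (Seq c1 c2) (at level 61, right associativity).

(* Cells 0 to 31 serve as registers, and the input is moved to the cells from
   [64 * n] on. *)
Notation rANS := 0%N (only parsing).
Notation rONE := 1%N (only parsing).
Notation rZERO := 2%N (only parsing).
Notation rLEN := 3%N (only parsing).
Notation rBASE := 4%N (only parsing).
Notation rRAD := 5%N (only parsing).
Notation rSTR := 6%N (only parsing).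
Notation rBLK := 7%N (only parsing).
Notation rT := 8%N (only parsing).
Notation rK := 9%N (only parsing).
Notation rOFF := 10%N (only parsing).
Notation rP := 11%N (only parsing).
Notation rQ := 12%N (only parsing).
Notation rG := 13%N (only parsing).
Notation rCNT := 14%N (only parsing).
Notation rJ := 15%N (only parsing).
Notation rPTR := 16%N (only parsing).
Notation rADDR := 17%N (only parsing).
Notation rADDR' := 18%N (only parsing).
Notation rACC := 19%N (only parsing).
Notation rBIT := 20%N (only parsing).
Notation rBIT' := 21%N (only parsing).
Notation rTMP := 22%N (only parsing).
Notation rEQ := 23%N (only parsing).
Notation rF := 24%N (only parsing).
Notation rF' := 25%N (only parsing).
Notation rPOW := 26%N (only parsing).

Definition move d a := Op (IAdd d a rZERO).

(** The set chosen at the vertex is not stored: its bits lie one stride apart, and the entries are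
    added as the bits are read. *)
Definition c_next (x : nat) : cmd :=
  Op (IConst rACC 0);;
  Op (IAdd rADDR rOFF x);;
  move rPTR rBASE;;
  move rJ rLEN;;
  While rJ (
    Op (IRand rBIT rADDR);;
    When rBIT (Op (ILoad rTMP rPTR);; Op (IAdd rACC rACC rTMP));;
    Op (IAdd rADDR rADDR rSTR);;
    Op (IAdd rPTR rPTR rONE);;
    Op (ISub rJ rJ rONE));;
  move x rACC.

(** The only test of the machine is positivity, so equality is refuted by a positive difference in
    either order. *)
Definition c_equal : cmd :=
  Op (IConst rEQ 1);;
  Op (ISub rTMP rP rQ);;
  When rTMP (Op (IConst rEQ 0));;
  Op (ISub rTMP rQ rP);;
  When rTMP (Op (IConst rEQ 0)).

Definition c_incomparable : cmd :=
  Op (IConst rF 0);;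
  Op (IConst rF' 0);;
  Op (IAdd rADDR rOFF rP);;
  Op (IAdd rADDR' rOFF rQ);;
  move rJ rLEN;;
  While rJ (
    Op (IRand rBIT rADDR);;
    Op (IRand rBIT' rADDR');;
    Op (ISub rTMP rBIT rBIT');;
    When rTMP (Op (IConst rF 1));;
    Op (ISub rTMP rBIT' rBIT);;
    When rTMP (Op (IConst rF' 1));;
    Op (IAdd rADDR rADDR rSTR);;
    Op (IAdd rADDR' rADDR' rSTR);;
    Op (ISub rJ rJ rONE)).

(** In the second loop incomparability is tested before the step, at the vertices whose sets are
    compared, and equality after it, on the sums of those same sets. *)
Definition c_trial : cmd :=
  move rP rRAD;;
  move rQ rRAD;;
  move rG rRAD;;
  move rCNT rT;;
  While rCNT (
    c_next rP;; c_next rQ;; c_next rQ;;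
    c_equal;; When rEQ (move rG rP);;
    Op (ISub rCNT rCNT rONE));;
  move rP rRAD;;
  move rQ rG;;
  move rCNT rT;;
  While rCNT (
    c_incomparable;; c_next rP;; c_next rQ;; c_equal;;
    When rEQ (When rF (When rF' (Op (IConst rANS 1))));;
    Op (ISub rCNT rCNT rONE));;
  Op (IAdd rOFF rOFF rBLK).

Definition c_trials : cmd := While rK (c_trial;; Op (ISub rK rK rONE)).

Definition same (D : seq nat) (g g' : memory) : Prop :=
  forall a, a \notin D -> g' a = g a.

Lemma same_upd D g g' a z : same D g g' -> a \in D -> same D g (upd g' a z).
Proof.
move=> H aD b bD; rewrite /= H //; case: eqP => // E.
by rewrite E aD in bD.
Qed.

Lemma same_trans D g g' g'' : same D g g' -> same D g' g'' -> same D g g''.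
Proof. by move=> H H' b bD; rewrite H' // H. Qed.

Lemma same_sub D D' g g' : same D g g' -> {subset D <= D'} -> same D' g g'.
Proof. by move=> H sub a aD; apply: H; apply: contra aD; apply: sub. Qed.

(** * Correctness and running time of one trial *)

Section Specs.
Variables (s : seq int) (rnd : seq bool) (A M T K : nat).
Local Notation n := (size s).
Local Notation wp := (wp rnd A M).

Hypothesis n_gt0 : (0 < n)%N.
(** The moved input ends at cell 65 n; the extra 32 cells leave room for the 31 saved ones when n is
    small. *)
Hypothesis A_ge : (65 * n + 32 <= A)%N.
(** The largest numbers held are addresses: of random bits within K blocks, with one more block as
    slack, and of memory cells. *)
Hypothesis M_ge : (K.+1 * block s + 65 * n + 64 <= M)%N.
Hypothesis T_le : (T <= M)%N.

Lemma wp_opS i c t Q g : ~~ is_jump i ->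
  ((effect rnd i g).1 < A)%N -> (`|(effect rnd i g).2| <= M)%N ->
  wp c t Q (upd g (effect rnd i g).1 (effect rnd i g).2) ->
  wp (Op i ;; c) (1 + t) Q g.
Proof. by move=> ji aA zM H; apply: wp_seq; apply: wp_op. Qed.

(* What the memory looks like before trial number [k]. *)
Record env (k : nat) (g : memory) : Prop := Env {
  env_one : g rONE = 1;
  env_zero : g rZERO = 0;
  env_len : g rLEN = n%:Z;
  env_base : g rBASE = (64 * n)%:Z;
  env_rad : g rRAD = (radius s)%:Z;
  env_str : g rSTR = (stride s)%:Z;
  env_blk : g rBLK = (block s)%:Z;
  env_T : g rT = T%:Z;
  env_off : g rOFF = (radius s + k * block s)%:Z;
  env_arr : forall i, (i < n)%N -> g (64 * n + i)%N = s`_i }.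

(** Exactly the cells below 64 that [env] does not constrain; the input starts at 64 n >= 64. *)
Definition work (a : nat) : bool := (a == 0)%N || (a == 9)%N || (10 < a < 64)%N.

Lemma env_same k D g g' : all work D -> env k g -> same D g g' -> env k g'.
Proof.
move=> /allP wD [e1 e2 e3 e4 e5 e6 e7 e8 e9 e10] H.
have W a : ~~ work a -> g' a = g a by move=> wa; apply: H; apply: contra wa; apply: wD.
split; rewrite ?W // => i lt; rewrite W ?e10 //.
by rewrite /work; apply/negP; clear -n_gt0 lt; lia.
Qed.

Lemma env_upd k g a z : work a -> env k g -> env k (upd g a z).
Proof.
move=> wa e; apply: (@env_same _ [:: a]) (e) _; first by rewrite /= wa.
by apply: same_upd; rewrite ?inE.
Qed.

Definition blk (k : nat) : seq bool := take (block s) (drop (k * block s) rnd).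

Lemma block_bound k : (k < K)%N ->
  (block s + k * block s + stride s + 65 * n + 64 <= M)%N.
Proof.
move=> kK; apply: leq_trans M_ge; rewrite -mulSn.
have : (k.+1 * block s <= K * block s)%N by rewrite leq_mul2r kK orbT.
have : (stride s <= block s)%N by rewrite /block leq_pmull.
by rewrite [(K.+1 * _)%N]mulSn; lia.
Qed.

(** Translates an address inside block k into the absolute one used by the machine, whose offset
    register already contains the radius. *)
Lemma nth_blk k v j : (`|v| <= radius s)%N -> (j < n)%N ->
  nth false (blk k) (`|((radius s)%:Z + v)%R| + j * stride s)%N =
  nth false rnd `|((radius s + k * block s)%:Z + v + (j * stride s)%:Z)%R|%N.
Proof.
move=> vR jn; rewrite /blk nth_take; last first.
  have : (j.+1 * stride s <= block s)%N by rewrite /block leq_mul2r jn orbT.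
  by rewrite mulSn /stride; lia.
by rewrite nth_drop; congr nth; lia.
Qed.

Definition psum (b : seq bool) (v : int) (j : nat) : int :=
  subsum [set i in hset s b v | (i < j)%N].

Lemma psum0 b v : psum b v 0 = 0.
Proof. by rewrite /psum /subsum big_pred0 // => i; rewrite !inE andbF. Qed.

Lemma psum_size b v : psum b v n = nxt s b v.
Proof. by apply: eq_bigl => i; rewrite !inE ltn_ord andbT. Qed.

Lemma psumS k v j : (`|v| <= radius s)%N -> (j < n)%N ->
  psum (blk k) v j.+1 = psum (blk k) v j +
    if nth false rnd `|((radius s + k * block s)%:Z + v + (j * stride s)%:Z)%R|%N
    then s`_j else 0.
Proof.
move=> vR jn; rewrite -nth_blk // /psum /subsum.
rewrite [LHS]big_mkcond (bigD1 (Ordinal jn)) //= addrC; congr (_ + _).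
  rewrite [RHS]big_mkcond [LHS]big_mkcond /=.
  apply: eq_bigr => i _; rewrite !inE.
  have -> : (i != Ordinal jn) = (i != j :> nat) by [].
  have -> : (i < j)%N = (i != j :> nat) && (i < j.+1)%N by rewrite ltnS ltn_neqAle.
  by case: (_ != _); rewrite ?andbF ?andbT.
by rewrite !inE /= ltnSn andbT.
Qed.

Lemma row_bound j : (j <= n)%N -> (j * stride s <= block s)%N.
Proof. by move=> jn; rewrite /block leq_mul2r jn orbT. Qed.

Lemma entry_bound j : (`|nth 0%R s j| <= radius s)%N.
Proof.
case: (ltnP j n) => jn; last by rewrite nth_default.
by rewrite /radius (big_nth 0) big_mkord (bigD1 (Ordinal jn)) //=; clear; lia.
Qed.

Lemma spec_next k v x g : (k < K)%N -> env k g -> x \in [:: rP; rQ] ->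
  g x = v -> (`|v| <= radius s)%N ->
  wp (c_next x) (10 * n + 7)
     (fun g' => same [:: x; rJ; rPTR; rADDR; rACC; rBIT; rTMP] g g' /\
                g' x = nxt s (blk k) v) g.
Proof.
move=> kK e xPQ gx vR; have BB := block_bound kK.
have sR : stride s = (radius s + radius s).+1 by [].
have [wx x19] : work x /\ (x == 19%N) = false by move: xPQ; rewrite !inE => /orP[] /eqP ->.
have xA : (x < A)%N by move: wx; rewrite /work; lia.
set D := [:: x; _; _; _; _; _; _].
have wD : all work D by rewrite /D /= wx.
pose I j (h : memory) := [/\ same D g h, h rJ = (n - j)%N%:Z,
  h rPTR = (64 * n + j)%N%:Z,
  h rADDR = (radius s + k * block s)%N%:Z + v + (j * stride s)%N%:Z
  & h rACC = psum (blk k) v j].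
eapply wp_le.
  apply: wp_opS => //=; [lia|].
  apply: wp_opS => //=; [lia| |].
    rewrite (env_off e) x19 gx; lia.
  apply: wp_opS => //=; [lia| |].
    rewrite (env_base e) (env_zero e); lia.
  apply: wp_opS => //=; [lia| |].
    rewrite (env_len e) (env_zero e); lia.
  apply: wp_seq; apply: (@wp_while _ _ _ _ _ _ n I) => [|j h jn|h].
  - split=> /=; first by do !apply: same_upd => //; rewrite !inE ?eqxx ?orbT.
    + by rewrite (env_len e) (env_zero e) subn0; lia.
    + by rewrite (env_base e) (env_zero e) addn0; lia.
    + by rewrite (env_off e) x19 gx; lia.
    + by rewrite psum0.
  - case=> S hJ hPTR hADDR hACC.
    have eh := env_same wD e S.
    split; first by rewrite hJ; lia.
    have RB := row_bound jn; rewrite mulSn in RB.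
    have EB := entry_bound j.
    apply: wp_opS => //=; [lia|case: (nth _ _ _) => /=; lia|].
    have PS := psumS k vR jn; rewrite -hADDR in PS.
    (* Partial sums are subset sums too, so the accumulator never exceeds the radius. *)
    have p1 := subsum_lt [set i in hset s (blk k) v | (i < j)%N].
    have p2 := subsum_lt [set i in hset s (blk k) v | (i < j.+1)%N].
    rewrite -/(psum _ _ _) in p1; rewrite -/(psum _ _ _) in p2.
    move: PS; set b := nth _ _ _ => PS.
    apply: wp_seq; apply: (@wp_mono _ _ _ _ _ (fun h' : memory =>
       same [:: 19; 20; 22]%N h h' /\ h' rACC = psum (blk k) v j.+1)).
      apply: wp_when => /= [b1|b0].
        have {}b1 : b by case: (b) b1.
        rewrite b1 in PS.
        apply: wp_opS => //=; [lia| |].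
          rewrite hPTR /= ifF ?(env_arr eh) //; lia.
        apply: wp_op => //=; [lia| |].
          rewrite hACC hPTR /= ifF ?(env_arr eh) //; [|lia]. rewrite -PS; lia.
        split; first by do !apply: same_upd => //; rewrite !inE ?eqxx ?orbT.
        by rewrite /= hACC hPTR /= ifF ?(env_arr eh) // ?PS //; lia.
      have {}b0 : b = false by case: (b) b0.
      rewrite b0 addr0 in PS.
      split; first by do !apply: same_upd => //; rewrite !inE ?eqxx ?orbT.
      by rewrite /= hACC.
    move=> h' [S' hACC'].
    apply: wp_opS => //=; [lia| |].
      rewrite !S' // hADDR (env_str eh). lia.
    apply: wp_opS => //=; [lia| |].
      rewrite !S' // hPTR (env_one eh). lia.
    apply: wp_op => //=; [lia| |].
      rewrite !S' // hJ (env_one eh). lia.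
    split => /=.
    + do !apply: same_upd => //; rewrite ?inE ?eqxx ?orbT //.
      apply: same_trans S _; apply: same_sub S' _.
      by apply/allP; rewrite /= !inE !eqxx ?orbT.
    + rewrite !S' // hJ (env_one eh); lia.
    + rewrite !S' // hPTR (env_one eh); lia.
    + rewrite !S' // hADDR (env_str eh) mulSn; lia.
    + by [].
  - case=> S hJ hPTR hADDR hACC; split; first by rewrite hJ subnn.
    have eh := env_same wD e S.
    have p1 := subsum_lt (hset s (blk k) v).
    apply: wp_op => //=.
    - rewrite hACC psum_size (env_zero eh) addr0 /nxt; lia.
    - split; last by rewrite eqxx hACC psum_size (env_zero eh) addr0.
      by apply: same_upd => //; rewrite inE eqxx.
lia.
Qed.
Lemma stride_le_M : (stride s <= M)%N.
Proof.
have : (stride s <= block s)%N by rewrite /block leq_pmull.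
by move: M_ge; rewrite mulSn; clear; lia.
Qed.

Lemma spec_equal g :
  (`|g rP| <= radius s)%N -> (`|g rQ| <= radius s)%N ->
  wp c_equal 9 (fun g' => same [:: rTMP; rEQ] g g' /\
                g' rEQ = (nat_of_bool (g rP == g rQ))%:Z) g.
Proof.
move=> Pb Qb; have SM := stride_le_M.
have sR : stride s = (radius s + radius s).+1 by [].
eapply wp_le.
  apply: wp_opS => //=; [lia|lia|].
  apply: wp_opS => //=; [lia|lia|].
  apply: wp_seq; apply: (@wp_mono _ _ _ _ _ (fun h : memory =>
     same [:: 22; 23]%N g h /\ h 23%N = (nat_of_bool (g 11%N <= g 12%N))%:Z)).
    apply: wp_when => /= [d|d].
      apply: wp_op => //=; [lia|].
      split; first by do !apply: same_upd.
      by rewrite /= (_ : (g 11%N <= g 12%N) = false) //; lia.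
    split; first by do !apply: same_upd.
    by rewrite /= (_ : (g 11%N <= g 12%N) = true) //; lia.
  move=> h [S hE].
  apply: wp_opS => //=; [lia|rewrite !S //; lia|].
  apply: wp_when => /= [d|d]; rewrite !S // in d.
    apply: wp_op => //=; [lia|].
    split; first by do !apply: same_upd.
    by rewrite /= (_ : (g 11%N == g 12%N) = false) //; lia.
  split; first by do !apply: same_upd.
  rewrite /= hE; congr (nat_of_bool _)%:Z; lia.
by [].
Qed.

Definition rbit (k : nat) (v : int) (j : nat) : bool :=
  nth false rnd `|((radius s + k * block s)%:Z + v + (j * stride s)%:Z)%R|%N.

Definition differ (k : nat) (v w : int) (j : nat) : bool :=
  has (fun i => rbit k v i && ~~ rbit k w i) (iota 0 j).

Lemma differS k v w j :
  differ k v w j.+1 = differ k v w j || (rbit k v j && ~~ rbit k w j).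
Proof. by rewrite /differ -addn1 iotaD has_cat /= orbF add0n. Qed.

Lemma differ_size k v w :
  (`|v| <= radius s)%N -> (`|w| <= radius s)%N ->
  differ k v w n = ~~ (hset s (blk k) v \subset hset s (blk k) w).
Proof.
move=> vR wR; apply/hasP/subsetPn => [[j]|[j]].
  rewrite mem_iota /= => jn; rewrite /rbit -!nth_blk // => /andP[b1 b2].
  by exists (Ordinal jn); rewrite inE.
rewrite !inE => b1 b2; exists (val j); first by rewrite mem_iota ltn_ord.
by rewrite /rbit -!nth_blk ?ltn_ord //; apply/andP.
Qed.

Lemma spec_incomparable k v w g : (k < K)%N -> env k g ->
  g rP = v -> g rQ = w -> (`|v| <= radius s)%N -> (`|w| <= radius s)%N ->
  wp c_incomparable (15 * n + 7)
    (fun g' => same [:: rJ; rADDR; rADDR'; rBIT; rBIT'; rTMP; rF; rF'] g g' /\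
      (0 < g' rF) && (0 < g' rF') =
        incomparable (hset s (blk k) v) (hset s (blk k) w)) g.
Proof.
move=> kK e gP gQ vR wR; have BB := block_bound kK.
have sR : stride s = (radius s + radius s).+1 by [].
set D := [:: _; _; _; _; _; _; _; _].
have wD : all work D by [].
pose I j (h : memory) := [/\ same D g h, h rJ = (n - j)%N%:Z,
  h rADDR = (radius s + k * block s)%N%:Z + v + (j * stride s)%N%:Z,
  h rADDR' = (radius s + k * block s)%N%:Z + w + (j * stride s)%N%:Z
  & h rF = (nat_of_bool (differ k v w j))%:Z /\
    h rF' = (nat_of_bool (differ k w v j))%:Z].
eapply wp_le.
  apply: wp_opS => //=; [lia|].
  apply: wp_opS => //=; [lia|].
  apply: wp_opS => //=; [lia|rewrite (env_off e) gP; lia|].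
  apply: wp_opS => //=; [lia|rewrite (env_off e) gQ; lia|].
  apply: wp_opS => //=; [lia|rewrite (env_len e) (env_zero e); lia|].
  apply: (@wp_while _ _ _ _ _ _ n I) => [|j h jn|h].
  - split=> /=; first by do !apply: same_upd.
    + by rewrite (env_len e) (env_zero e) subn0; lia.
    + by rewrite (env_off e) gP; lia.
    + by rewrite (env_off e) gQ; lia.
    + by [].
  - case=> S hJ hA hA' [hF hF'].
    have eh := env_same wD e S.
    split; first by rewrite hJ; lia.
    have RB := row_bound jn; rewrite mulSn in RB.
    apply: wp_opS => //=; [lia|case: (nth _ _ _) => /=; lia|].
    apply: wp_opS => //=; [lia|case: (nth _ _ _) => /=; lia|].
    rewrite hA hA' -/(rbit k v j) -/(rbit k w j).
    apply: wp_opS => //=; [lia|case: (rbit _ _ _); case: (rbit _ _ _) => /=; lia|].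
    set h1 := upd _ 22 _.
    apply: wp_seq; apply: (@wp_mono _ _ _ _ _ (fun h' : memory =>
       same [:: 24]%N h1 h' /\ h' 24%N = (nat_of_bool (differ k v w j.+1))%:Z)).
      apply: wp_when => [d|d]; rewrite /h1 /= in d.
        apply: wp_op => //=; [lia|lia|]; split=> /=; first exact: same_upd.
        by rewrite differS; case: (rbit k v j) d; case: (rbit k w j); rewrite //= ?orbT.
      split=> //=.
      by rewrite /h1 /= differS hF; case: (rbit k v j) d; case: (rbit k w j); rewrite //= ?orbF.
    move=> h2 [S2 hF2].
    apply: wp_opS => //=; [lia|rewrite !S2 // /h1 /=; case: (rbit _ _ _); case: (rbit _ _ _) => /=; lia|].
    rewrite !S2 // /h1 /= -/h1.
    set h3 := upd h2 22 _.
    apply: wp_seq; apply: (@wp_mono _ _ _ _ _ (fun h' : memory =>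
       same [:: 25]%N h3 h' /\ h' 25%N = (nat_of_bool (differ k w v j.+1))%:Z)).
      apply: wp_when => [d|d]; rewrite /h3 /= in d.
        apply: wp_op => //=; [lia|lia|]; split=> /=; first exact: same_upd.
        by rewrite differS; case: (rbit k w j) d; case: (rbit k v j); rewrite //= ?orbT.
      split=> //=.
      by rewrite /h3 /= S2 // /h1 /= differS hF'; case: (rbit k w j) d; case: (rbit k v j); rewrite //= ?orbF.
    move=> h4 [S4 hF4].
    have S' a : a \notin [:: 20; 21; 22; 24; 25]%N -> h4 a = h a.
      rewrite !inE !negb_or => /and5P[a1 a2 a3 a4 a5].
      rewrite S4 ?inE // /h3 /= (negbTE a3) S2 ?inE // /h1 /=.
      by rewrite (negbTE a1) (negbTE a2) (negbTE a3).
    apply: wp_opS => //=; [lia|rewrite !S' // hA (env_str eh); lia|].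
    apply: wp_opS => //=; [lia|rewrite !S' // hA' (env_str eh); lia|].
    apply: wp_op => //=; [lia|rewrite !S' // hJ (env_one eh); lia|].
    split => /=.
    + do !apply: same_upd => //.
      by apply: same_trans S _; apply: same_sub (S' : same _ h h4) _; apply/allP.
    + rewrite !S' // hJ (env_one eh); lia.
    + rewrite !S' // hA (env_str eh) mulSn; lia.
    + rewrite !S' // hA' (env_str eh) mulSn; lia.
    + by split=> //; rewrite S4.
  - case=> S hJ hA hA' [hF hF']; split; first by rewrite hJ subnn.
    split=> //; rewrite hF hF' !differ_size // /incomparable.
    by case: (_ \subset _); case: (_ \subset _).
lia.
Qed.
Lemma nxt_bound b v : (`|nxt s b v| <= radius s)%N.
Proof. exact/ltnW/subsum_lt. Qed.

Lemma iter_bound b i v : (`|v| <= radius s)%N ->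
  (`|iter i (nxt s b) v| <= radius s)%N.
Proof. by case: i => //= i _; apply: nxt_bound. Qed.

Lemma meet_bound b t : (`|meet (nxt s b) (start s) t| <= radius s)%N.
Proof.
elim: t => [|t IH] /=; first by rewrite /start.
by case: ifP => // _; apply: nxt_bound.
Qed.

Definition trial_regs : seq nat :=
  [:: rANS; rP; rQ; rG; rCNT; rJ; rPTR; rADDR; rADDR'; rACC; rBIT; rBIT'; rTMP;
      rEQ; rF; rF'].

Lemma spec_trial k (a : bool) g : (k < K)%N -> env k g ->
  g rANS = (nat_of_bool a)%:Z ->
  wp c_trial (T * (65 * n + 76) + 12)
    (fun g' => [/\ same (rOFF :: trial_regs) g g', env k.+1 g' &
       g' rANS = (nat_of_bool (a || trial s T (blk k)))%:Z]) g.
Proof.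
move=> kK e ga; have BB := block_bound kK.
have sR : stride s = (radius s + radius s).+1 by [].
set b := blk k; set f := nxt s b; set v0 := start s.
have v0R : (`|v0| <= radius s)%N by rewrite /v0 /start.
have wD : all work trial_regs by [].
pose I j (h : memory) := [/\ same trial_regs g h, h rCNT = (T - j)%N%:Z,
  h rP = iter j f v0, h rQ = iter (j + j) f v0
  & h rG = meet f v0 j /\ h rANS = (nat_of_bool a)%:Z].
(* One walker restarts at the start, the other at the recorded meeting point; the answer keeps the
   outcome a of earlier trials. *)
pose I2 j (h : memory) := [/\ same trial_regs g h, h rCNT = (T - j)%N%:Z,
  h rP = iter j f v0, h rQ = iter j f (meet f v0 T)
  & h rANS = (nat_of_bool (a || has (fun i =>
      good s b (iter i f v0) (iter i f (meet f v0 T))) (iota 0 j)))%:Z].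
have sub (l : seq nat) h h' : same trial_regs g h -> same l h h' -> all (mem trial_regs) l ->
    same trial_regs g h'.
  by move=> S S' /allP al; apply: same_trans S _; apply: same_sub S' al.
eapply wp_le.
  apply: wp_opS => //=; [lia|rewrite (env_rad e) (env_zero e); lia|].
  apply: wp_opS => //=; [lia|rewrite (env_rad e) (env_zero e); lia|].
  apply: wp_opS => //=; [lia|rewrite (env_rad e) (env_zero e); lia|].
  apply: wp_opS => //=; [lia|rewrite (env_T e) (env_zero e); lia|].
  apply: wp_seq; apply: (@wp_while _ _ _ _ _ _ T I) => [|j h jT|h].
  - split=> /=; first by do !apply: same_upd.
    + by rewrite (env_T e) (env_zero e) subn0; lia.
    + by rewrite (env_rad e) (env_zero e) addr0.
    + by rewrite (env_rad e) (env_zero e) addr0.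
    + by rewrite (env_rad e) (env_zero e) addr0.
  - case=> S hC hP hQ [hG hA]; split; first by rewrite hC; lia.
    have eh := env_same wD e S.
    apply: wp_seq; apply: wp_mono (spec_next kK eh _ hP (iter_bound _ _ v0R)) _ => //.
    move=> h1 [S1 P1]; have {}S := sub _ _ _ S S1 isT; have e1 := env_same wD e S.
    have hQ1 : h1 rQ = iter (j + j) f v0 by rewrite S1.
    apply: wp_seq; apply: wp_mono (spec_next kK e1 _ hQ1 (iter_bound _ _ v0R)) _ => //.
    move=> h2 [S2 P2]; have {}S := sub _ _ _ S S2 isT; have e2 := env_same wD e S.
    apply: wp_seq; apply: wp_mono (spec_next kK e2 _ P2 (nxt_bound _ _)) _ => //.
    move=> h3 [S3 P3]; have {}S := sub _ _ _ S S3 isT; have e3 := env_same wD e S.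
    have h3P : h3 rP = iter j.+1 f v0 by rewrite S3 // S2 // P1.
    have h3Q : h3 rQ = iter (j.+1 + j.+1) f v0 by rewrite P3 addSn addnS.
    have hG3 : h3 rG = meet f v0 j by rewrite S3 // S2 // S1.
    have hA3 : h3 rANS = (nat_of_bool a)%:Z by rewrite S3 // S2 // S1.
    have hC3 : h3 rCNT = (T - j)%N%:Z by rewrite S3 // S2 // S1.
    apply: wp_seq; apply: wp_mono (spec_equal _ _) _; first by rewrite h3P nxt_bound.
      by rewrite h3Q addSn nxt_bound.
    move=> h4 [S4 E4]; have {}S := sub _ _ _ S S4 isT; have e4 := env_same wD e S.
    apply: wp_seq; apply: (@wp_mono _ _ _ _ _ (fun h' : memory =>
       same [:: rG] h4 h' /\ h' rG = meet f v0 j.+1)).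
      apply: wp_when => /= [d|d]; rewrite E4 in d.
        have NB := nxt_bound b (iter j f v0).
        apply: wp_op => //=; [lia|rewrite (env_zero e4) S4 // h3P addr0 /=; apply: leq_trans NB _; lia|].
        split; first exact: same_upd.
        rewrite /= (env_zero e4) addr0 S4 // h3P.
        by move: d; rewrite h3P h3Q /=; case: eqP.
      split=> //; rewrite S4 // hG3 /=.
      by move: d; rewrite h3P h3Q /=; case: eqP.
    move=> h5 [S5 G5]; have {}S := sub _ _ _ S S5 isT; have e5 := env_same wD e S.
    apply: wp_op => //=; [lia|rewrite (env_one e5) S5 // S4 // hC3; lia|].
    split=> /=; first exact: same_upd.
    + by rewrite (env_one e5) S5 // S4 // hC3; lia.
    + by rewrite S5 // S4 // h3P.
    + by rewrite S5 // S4 // h3Q.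
    + by rewrite G5 S5 // S4.
  - case=> S hC hP hQ [hG hA]; split; first by rewrite hC subnn.
    have eh := env_same wD e S.
    apply: wp_opS => //=; [lia|rewrite (env_rad eh) (env_zero eh); lia|].
    apply: wp_opS => //=; [lia|rewrite (env_zero eh) addr0 hG; have := meet_bound b T; rewrite -/f -/v0; lia|].
    apply: wp_opS => //=; [lia|rewrite (env_T eh) (env_zero eh); lia|].
    apply: wp_seq; apply: (@wp_while _ _ _ _ _ _ T I2) => [|j h' jT|h'].
    + split=> /=; first by do !apply: same_upd.
      * by rewrite (env_T eh) (env_zero eh) subn0; lia.
      * by rewrite (env_rad eh) (env_zero eh) addr0.
      * by rewrite hG (env_zero eh) addr0.
      * by rewrite orbF.
    + move=> {S hC hP hQ hG hA eh}[S hC hP hQ hA]; split; first by rewrite hC; lia.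
      have eh := env_same wD e S.
      have vR := iter_bound b j v0R; have wR := iter_bound b j (meet_bound b T).
      apply: wp_seq; apply: wp_mono (spec_incomparable kK eh hP hQ vR wR) _.
      move=> h0 [S0 P0]; have {}S := sub _ _ _ S S0 isT; have e0 := env_same wD e S.
      have hP0 : h0 rP = iter j f v0 by rewrite S0.
      have hQ0 : h0 rQ = iter j f (meet f v0 T) by rewrite S0.
      apply: wp_seq; apply: wp_mono (spec_next kK e0 _ hP0 vR) _ => //.
      move=> h1 [S1 P1]; have {}S := sub _ _ _ S S1 isT; have e1 := env_same wD e S.
      have hQ1 : h1 rQ = iter j f (meet f v0 T) by rewrite S1.
      apply: wp_seq; apply: wp_mono (spec_next kK e1 _ hQ1 wR) _ => //.
      move=> h2 [S2 P2]; have {}S := sub _ _ _ S S2 isT; have e2 := env_same wD e S.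
      have h2P : h2 rP = iter j.+1 f v0 by rewrite S2 // P1.
      apply: wp_seq; apply: wp_mono (spec_equal _ _) _; first by rewrite h2P nxt_bound.
        by rewrite P2 nxt_bound.
      move=> h4 [S4 E4]; have {}S := sub _ _ _ S S4 isT; have e4 := env_same wD e S.
      have F4 : (0 < h4 rF) && (0 < h4 rF') =
          incomparable (hset s b (iter j f v0)) (hset s b (iter j f (meet f v0 T))).
        by rewrite -P0 !S4 // !S2 // !S1.
      have A4 : h4 rANS = h' rANS by rewrite S4 // S2 // S1 // S0.
      have C4 : h4 rCNT = h' rCNT by rewrite S4 // S2 // S1 // S0.
      rewrite h2P P2 in E4.
      apply: wp_seq; apply: (@wp_mono _ _ _ _ _ (fun h' : memory =>
         same [:: rANS] h4 h' /\ h' rANS = (nat_of_bool (a || has (fun i =>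
          good s b (iter i f v0) (iter i f (meet f v0 T))) (iota 0 j.+1)))%:Z)).
        have G4 : good s b (iter j f v0) (iter j f (meet f v0 T)) =
            (0 < h4 rEQ) && ((0 < h4 rF) && (0 < h4 rF')).
          by rewrite F4 E4 /good andbC /=; case: eqP.
        have HS : has (fun i => good s b (iter i f v0) (iter i f (meet f v0 T))) (iota 0 j.+1) =
            has (fun i => good s b (iter i f v0) (iter i f (meet f v0 T))) (iota 0 j) ||
            ((0 < h4 rEQ) && ((0 < h4 rF) && (0 < h4 rF'))).
          by rewrite -addn1 iotaD has_cat [has _ (iota _ 1)]/= orbF add0n G4.
        rewrite HS; apply: wp_when => [d1|/negbTE d1]; last first.
          by split=> //; rewrite d1 /= orbF A4.
        apply: wp_when => [d2|/negbTE d2]; last first.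
          by split=> //; rewrite d2 andbF /= orbF A4.
        apply: wp_when => [d3|/negbTE d3]; last first.
          by split=> //; rewrite d3 !andbF /= orbF A4.
        apply: wp_op => //=; [lia|lia|].
        by split; [exact: same_upd|rewrite /= d1 d2 d3 !orbT].
      move=> h5 [S5 G5]; have {}S := sub _ _ _ S S5 isT; have e5 := env_same wD e S.
      apply: wp_op => //=; [lia|rewrite (env_one e5) S5 // C4 hC; lia|].
      split=> /=; first exact: same_upd.
      * by rewrite (env_one e5) S5 // C4 hC; lia.
      * by rewrite S5 // S4 // h2P.
      * by rewrite S5 // S4 // P2.
      * exact: G5.
    + move=> {S hC hP hQ hG hA eh}[S hC hP hQ hA]; split; first by rewrite hC subnn.
      have eh := env_same wD e S.
      apply: wp_op => //=; [lia|rewrite (env_off eh) (env_blk eh); lia|].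
      split.
      * by apply: same_upd => //; apply: same_sub S _ => x xD; rewrite inE xD orbT.
      * case: eh => e1 e2 e3 e4 e5 e6 e7 e8 e9 e10; split=> //=.
          by rewrite e9 e7 mulSn; lia.
        by move=> i lt; rewrite ifF ?e10 //; lia.
      * by rewrite /= hA.
nia.
Qed.
End Specs.

(** Unrolled, because no register is free for a loop counter yet: cell 0 is the write pointer and
    cell 1 the constant 1. The last instruction is a harmless repetition that serves as base
    case. *)
Fixpoint c_save (i d : nat) : cmd :=
  if d is d'.+1 then
    Op (IAdd 0 0 1);; Op (IStore 0 i);; c_save i.+1 d'
  else Op (IConst 1 1).

Arguments c_save : simpl never.

(* The input fills the cells from 0 on, so at first only cell 0 is available:
   doubling it six times gives an address beyond both the input and the
   registers, where the contents of cells 1 to 31 are saved. *)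
Definition c_boot : cmd :=
  Op (IAdd 0 0 0);; Op (IAdd 0 0 0);; Op (IAdd 0 0 0);;
  Op (IAdd 0 0 0);; Op (IAdd 0 0 0);; Op (IAdd 0 0 0);;
  Op (IStore 0 1);; Op (IConst 1 1);; c_save 2 30.

(** Cell 0 holds 64 n + 30 by now, so n is recovered by counting how often 64 can be subtracted from
    64 n. The 31 entries from the register cells are already in place; the rest follows. *)
Definition c_copy : cmd :=
  Op (IConst rZERO 0);;
  Op (IConst rTMP 30);; Op (ISub rBASE 0 rTMP);;
  Op (IConst rLEN 0);; move rJ rBASE;; Op (IConst rTMP 64);;
  While rJ (Op (IAdd rLEN rLEN rONE);; Op (ISub rJ rJ rTMP));;
  Op (IConst rTMP 31);; Op (ISub rCNT rLEN rTMP);;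
  Op (IConst rPTR 32);; Op (IAdd rADDR 0 rONE);;
  While rCNT (
    Op (ILoad rTMP rPTR);; Op (IStore rADDR rTMP);;
    Op (IAdd rPTR rPTR rONE);; Op (IAdd rADDR rADDR rONE);;
    Op (ISub rCNT rCNT rONE)).

(** The absolute value of z arises by adding z if positive, then -z if positive. *)
Definition c_radius : cmd :=
  Op (IConst rRAD 1);; move rPTR rBASE;; move rJ rLEN;;
  While rJ (
    Op (ILoad rTMP rPTR);; When rTMP (Op (IAdd rRAD rRAD rTMP));;
    Op (ISub rTMP rZERO rTMP);; When rTMP (Op (IAdd rRAD rRAD rTMP));;
    Op (IAdd rPTR rPTR rONE);; Op (ISub rJ rJ rONE)).

(** Multiplication is repeated addition and powers are repeated doubling. The counter of the last
    loop drops by 2, so the walk length is doubled [uphalf n] times, which puts it at or above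
    2^(n/2). *)
Definition c_sizes : cmd :=
  Op (IAdd rSTR rRAD rRAD);; Op (IAdd rSTR rSTR rONE);;
  Op (IConst rBLK 0);; Op (IConst rPOW 512);; move rJ rLEN;;
  While rJ (
    Op (IAdd rBLK rBLK rSTR);; Op (IAdd rPOW rPOW rPOW);;
    Op (ISub rJ rJ rONE));;
  Op (IConst rK 0);; move rJ rLEN;;
  While rJ (Op (IAdd rK rK rPOW);; Op (ISub rJ rJ rONE));;
  Op (IConst rT 1);; move rJ rLEN;; Op (IConst rTMP 2);;
  While rJ (Op (IAdd rT rT rT);; Op (ISub rJ rJ rTMP));;
  move rOFF rRAD;; Op (IConst rANS 0).

(** Cell 0 holds n. On the empty input it is 0, which is already the rejecting answer; otherwise 64
    n lies beyond all registers. *)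
Definition c_main : cmd :=
  When 0 (c_boot;; c_copy;; c_radius;; c_sizes;; c_trials).

(** * Loading the input, and correctness of the whole program *)

Section Boot.
Variables (s : seq int) (rnd : seq bool) (A M : nat).
Local Notation n := (size s).
Local Notation T := (2 ^ uphalf n)%N.
Local Notation K := (trials n).
Local Notation wp := (wp rnd A M).

Hypothesis A_ge : (65 * n + 32 <= A)%N.
Hypothesis M_ge : (K.+1 * block s + 65 * n + 64 <= M)%N.
Hypothesis T_le : (T <= M)%N.

Lemma spec_trials g : (0 < n)%N -> env s T 0 g -> g rK = K%:Z -> g rANS = 0 ->
  wp c_trials (K * (T * (65 * n + 76) + 15) + 2)
    (fun g' => g' rANS = (nat_of_bool (solve s K T rnd))%:Z) g.
Proof.
move=> n0 e gK gA.
have KM : (K <= M)%N.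
  apply: leq_trans M_ge; have : (0 < block s)%N by rewrite muln_gt0 n0.
  by rewrite mulSn; nia.
pose I k (h : memory) := [/\ env s T k h, h rK = (K - k)%N%:Z &
  h rANS = (nat_of_bool (has (fun k => trial s T (blk s rnd k)) (iota 0 k)))%:Z].
eapply wp_le.
  apply: (@wp_while _ _ _ _ _ _ K I) => [|k h kK|h [e' hK hA]].
  - by split=> //; rewrite subn0.
  - move=> [e' hK hA]; split; first by rewrite hK; lia.
    apply: wp_seq; apply: wp_mono (spec_trial rnd n0 A_ge M_ge T_le kK e' hA) _.
    move=> h1 [S e1 hA1].
    have K1 : h1 rK = (K - k)%N%:Z by rewrite S.
    apply: wp_op => //=; [lia|rewrite (env_one e1) K1; lia|].
    split.
    + exact: (env_upd n0).
    + by rewrite /= (env_one e1) K1; lia.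
    + by rewrite -[k.+1]addn1 iotaD has_cat [has _ (iota _ 1)]/= orbF; apply: hA1.
  - by split; [rewrite hK subnn|rewrite hA].
lia.
Qed.

(** The state in which cell i is next to be saved: cell a held entry a - 1 originally, and cell 0
    points to the slot written last. *)
Record saved (i : nat) (h : memory) : Prop := Saved {
  saved_ptr : h 0%N = (64 * n + (i - 2))%N%:Z;
  saved_one : h 1%N = 1;
  saved_new : forall l, (l < i - 1)%N -> h (64 * n + l)%N = s`_l;
  saved_old : forall a, (i <= a < 64 * n)%N -> h a = s`_(a.-1) }.

Lemma entry_le_M a : (0 < n)%N -> (`|nth 0%R s a| <= M)%N.
Proof.
move=> n0; apply: leq_trans (entry_bound s a) _.
have := stride_le_M n0 M_ge; rewrite /stride; lia.
Qed.

Lemma spec_save i d h : (0 < n)%N -> (1 < i)%N -> (i + d <= 32)%N -> saved i h ->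
  wp (c_save i d) (2 * d + 1) (saved (i + d)) h.
Proof.
move=> n0; elim: d i h => [|d IH] i h i1 id [h0 h1 hn ho]; rewrite /c_save -/c_save.
  apply: wp_op => //=; [lia|lia|]; rewrite addn0; split=> //=.
  - by move=> l lt; rewrite ifF ?hn //; lia.
  - by move=> a lt; rewrite ifF ?ho //; lia.
rewrite (_ : (2 * d.+1 + 1 = 1 + (1 + (2 * d + 1)))%N); last by lia.
apply: wp_opS => //=; [lia|rewrite h0 h1; lia|].
have EA : `|(h 0%N + h 1%N)%R|%N = (64 * n + (i - 1))%N by rewrite h0 h1; lia.
have hi : h i = s`_(i.-1) by apply: ho; lia.
apply: wp_opS => //=; [rewrite EA; lia|rewrite (_ : (i == 0)%N = false) ?hi ?entry_le_M //; lia|].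
have := IH i.+1; rewrite (addSnnS i d); apply; [lia|lia|]; rewrite EA (_ : (i == 0)%N = false) ?hi; last lia.
split=> /=.
- by rewrite ifF ?h0 ?h1; lia.
- by rewrite ifF ?h1; lia.
- move=> l lt; case: eqP => [E|NE]; first by congr nth; lia.
  by rewrite ifF ?hn //; lia.
- by move=> a lt; rewrite !ifF ?ho //; lia.
Qed.

Lemma spec_boot : (0 < n)%N ->
  wp c_boot 69 (saved 32) (nth 0 (n%:Z :: s)).
Proof.
move=> n0; set g := nth 0 _; have g0 : g 0%N = n%:Z by [].
have gS a : g a.+1 = s`_a by [].
eapply wp_le.
  do 6 (apply: wp_opS => //=; [lia|rewrite ?g0; lia|]).
  set x := (X in upd _ 0 X); have Ex : x = (64 * n)%N%:Z by rewrite /x g0; lia.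
  clearbody x.
  apply: wp_opS => //=; [rewrite Ex; lia|by rewrite gS entry_le_M|].
  apply: wp_opS => //=; [lia|lia|].
  apply: spec_save => //; split=> /=.
  - by rewrite ifF ?Ex; lia.
  - by [].
  - move=> l lt; have -> : l = 0%N by lia.
    by rewrite Ex addn0 eqxx ifF //; lia.
  - move=> a lt; rewrite Ex !ifF; try lia.
    by case: a lt => [|a] lt; [lia|rewrite gS].
by [].
Qed.
Record loaded (h : memory) : Prop := Loaded {
  loaded_one : h rONE = 1;
  loaded_zero : h rZERO = 0;
  loaded_len : h rLEN = n%:Z;
  loaded_base : h rBASE = (64 * n)%N%:Z;
  loaded_arr : forall i, (i < n)%N -> h (64 * n + i)%N = s`_i }.

Lemma loaded_upd h a z : (0 < n)%N -> (a == 0)%N || (4 < a < 64)%N ->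
  loaded h -> loaded (upd h a z).
Proof.
move=> n0 aP [h1 h2 h3 h4 arr].
have W b : (b != a) -> upd h a z b = h b by move=> ne; rewrite /= (negbTE ne).
split; rewrite ?W //; try by apply/eqP => E; move: aP; rewrite -E.
by move=> i lt; rewrite W ?arr //; clear -n0 lt aP; lia.
Qed.

Lemma spec_copy h : (0 < n)%N -> saved 32 h ->
  wp c_copy (11 * n + 14) loaded h.
Proof.
move=> n0 [h0 h1 hn ho].
pose I1 j (g : memory) := [/\ same [:: 2; 3; 4; 15; 22]%N h g, g 2%N = 0,
  g 3%N = j%:Z, g 4%N = (64 * n)%N%:Z & g 15%N = (64 * (n - j))%N%:Z /\ g 22%N = 64].
pose I2 j (g : memory) := [/\
  [/\ g rONE = 1, g rZERO = 0, g rLEN = n%:Z & g rBASE = (64 * n)%N%:Z],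
  forall l, (l < 31 + j)%N -> g (64 * n + l)%N = s`_l,
  forall a, (32 + j <= a < 64 * n)%N -> g a = s`_(a.-1),
  g rCNT = n%:Z - 31 - j%:Z
  & g rPTR = (32 + j)%N%:Z /\ g rADDR = (64 * n + 31 + j)%N%:Z].
eapply wp_le.
  apply: wp_opS => //=; [lia|].
  apply: wp_opS => //=; [lia|lia|].
  apply: wp_opS => //=; [lia|rewrite h0; lia|].
  apply: wp_opS => //=; [lia|].
  apply: wp_opS => //=; [lia|rewrite h0; lia|].
  apply: wp_opS => //=; [lia|lia|].
  apply: wp_seq; apply: (@wp_while _ _ _ _ _ _ n I1) => [|j g jn|g].
  - split=> //=; first by do !apply: same_upd.
    + by rewrite h0; lia.
    + by rewrite h0; lia.
  - move=> [S g2 g3 g4 [g15 g22]]; split; first by rewrite g15; lia.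
    apply: wp_opS => //=; [lia|rewrite g3 S // h1; lia|].
    apply: wp_op => //=; [lia|rewrite g15 g22; lia|].
    split=> //=; first by do !apply: same_upd.
    + by rewrite g3 S // h1; lia.
    + by split=> //; rewrite g15 g22; lia.
  - move=> [S g2 g3 g4 [g15 g22]]; split; first by rewrite g15 subnn.
    have g0 : g 0%N = (64 * n + 30)%N%:Z by rewrite S // h0; lia.
    have g1 : g 1%N = 1 by rewrite S // h1.
    apply: wp_opS => //=; [lia|lia|].
    apply: wp_opS => //=; [lia|rewrite g3; lia|].
    apply: wp_opS => //=; [lia|lia|].
    apply: wp_opS => //=; [lia|rewrite g0 g1; lia|].
    (* For n <= 31 the counter is not positive and the truncated difference is 0: nothing remains to
       be copied. *)
    apply: (@wp_while _ _ _ _ _ _ (n - 31) I2) => [|j g' jn|g'].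
    + split=> //=.
      * move=> l lt; rewrite !ifF; try by clear -n0; lia.
        rewrite S; first by rewrite hn //; lia.
        by rewrite !inE !negb_or; clear -n0; lia.
      * move=> a lt; rewrite !ifF; try by clear -lt; lia.
        rewrite S; first by rewrite ho //; lia.
        by rewrite !inE !negb_or; clear -lt; lia.
      * rewrite g3; lia.
      * by split=> //; rewrite g0 g1; lia.
    + move=> [[e1 e2 e3 e4] en eo eC [eP eA]]; split; first by rewrite eC; lia.
      have ge : g' (32 + j)%N = s`_(31 + j) by rewrite eo //; lia.
      apply: wp_opS => //=; [lia|rewrite eP /= ge entry_le_M //|].
      have EA : `|g' rADDR|%N = (64 * n + 31 + j)%N by rewrite eA; lia.
      apply: wp_opS => //=; [rewrite EA; lia|rewrite eP /= ge entry_le_M //|].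
      rewrite EA eP /= ge.
      have N a : (a < 32)%N -> (a == 64 * n + 31 + j)%N = false by clear -n0; lia.
      apply: wp_opS => //=; [lia|rewrite !N // eP e1; lia|].
      apply: wp_opS => //=; [lia|rewrite !N // eA e1; lia|].
      apply: wp_op => //=; [lia|rewrite !N // eC e1; lia|].
      rewrite !N //; split=> /=.
      * by rewrite !N.
      * move=> l lt; do 3 (rewrite ifF; last by clear -n0; lia).
        case: eqP => [E|NE]; first by congr nth; clear -E; lia.
        rewrite ifF ?en //; [clear -lt NE; lia|clear -n0; lia].
      * move=> a lt; rewrite !ifF; try by clear -lt; lia.
        by rewrite eo //; clear -lt; lia.
      * rewrite eC e1; lia.
      * by rewrite eP eA e1; split; lia.
    + move=> [[e1 e2 e3 e4] en eo eC [eP eA]]; split; first by rewrite eC; lia.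
      by split=> // i lt; rewrite en //; lia.
lia.
Qed.

Definition pradius (j : nat) : nat := (\sum_(z <- take j s) `|z|%N).+1.

Lemma pradiusS j : (j < n)%N -> pradius j.+1 = (pradius j + `|nth 0%R s j|)%N.
Proof. by move=> jn; rewrite /pradius (take_nth 0 jn) -cats1 big_cat big_seq1 addSn. Qed.

Lemma pradius_le j : (pradius j <= radius s)%N.
Proof. by rewrite /radius -{1}(cat_take_drop j s) big_cat ltnS leq_addr. Qed.

Lemma spec_radius h : (0 < n)%N -> loaded h ->
  wp c_radius (12 * n + 5) (fun g => loaded g /\ g rRAD = (radius s)%:Z) h.
Proof.
move=> n0 e; have SM := stride_le_M n0 M_ge.
have sR : stride s = (radius s + radius s).+1 by [].
pose I j (g : memory) := [/\ loaded g, g rRAD = (pradius j)%:Z,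
  g rPTR = (64 * n + j)%N%:Z & g rJ = (n - j)%N%:Z].
eapply wp_le.
  apply: wp_opS => //=; [lia|lia|].
  apply: wp_opS => //=; [lia|rewrite (loaded_base e) (loaded_zero e); lia|].
  apply: wp_opS => //=; [lia|rewrite (loaded_len e) (loaded_zero e); lia|].
  apply: (@wp_while _ _ _ _ _ _ n I) => [|j g jn|g].
  - split=> /=; first by do !apply: loaded_upd => //.
    + by rewrite /pradius take0 big_nil.
    + by rewrite (loaded_base e) (loaded_zero e); lia.
    + by rewrite (loaded_len e) (loaded_zero e); lia.
  - move=> [eg gR gP gJ]; split; first by rewrite gJ; lia.
    have P1 := pradiusS jn; have P2 := pradius_le j.+1.
    have EM := entry_le_M j n0.
    have [z zE] : exists z : int, s`_j = z by exists s`_j.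
    have gx : g `|g rPTR|%N = z by rewrite gP -zE (loaded_arr eg).
    rewrite zE in P1 EM.
    apply: wp_opS => //=; [lia|rewrite gx //|].
    rewrite gx; set g1 := upd g 22 _.
    apply: wp_seq; apply: (@wp_mono _ _ _ _ _ (fun g' : memory => same [:: rRAD] g1 g' /\
        g' rRAD = (pradius j)%:Z + Num.max 0 z)).
      apply: wp_when => [d|d]; rewrite /g1 /= in d.
        apply: wp_op => //=; [lia|rewrite /g1 /= gR; lia|].
        by split; [exact: same_upd|rewrite /g1 /= gR; lia].
      by split=> //; rewrite /g1 /= gR; lia.
    move=> g2 [S2 R2].
    have eg1 : loaded g1 by apply: loaded_upd.
    have eg2 : loaded g2.
      case: eg1 => a1 a2 a3 a4 a5; split; rewrite ?S2 // => i lt.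
      by rewrite S2 ?a5 // !inE; clear -n0; lia.
    have T2 : g2 rTMP = z by rewrite S2.
    apply: wp_opS => //=; [lia|rewrite T2 (loaded_zero eg2) sub0r abszN //|].
    rewrite T2 (loaded_zero eg2) sub0r; set g3 := upd g2 22 _.
    apply: wp_seq; apply: (@wp_mono _ _ _ _ _ (fun g' : memory => same [:: rRAD] g3 g' /\
        g' rRAD = (pradius j.+1)%:Z)).
      apply: wp_when => [d|d]; rewrite /g3 /= in d.
        apply: wp_op => //=; [lia|rewrite /g3 /= R2; lia|].
        by split; [exact: same_upd|rewrite /g3 /= R2; lia].
      by split=> //; rewrite /g3 /= R2; lia.
    move=> g4 [S4 R4].
    have eg3 : loaded g3 by apply: loaded_upd.
    have eg4 : loaded g4.
      case: eg3 => a1 a2 a3 a4 a5; split; rewrite ?S4 // => i lt.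
      by rewrite S4 ?a5 // !inE; clear -n0; lia.
    have P4 : g4 rPTR = (64 * n + j)%N%:Z by rewrite S4 // /g3 /= S2.
    have J4 : g4 rJ = (n - j)%N%:Z by rewrite S4 // /g3 /= S2.
    apply: wp_opS => //=; [lia|rewrite P4 (loaded_one eg4); lia|].
    apply: wp_op => //=; [lia|rewrite J4 (loaded_one eg4); lia|].
    split=> /=; first by do !apply: loaded_upd => //.
    + by [].
    + by rewrite P4 (loaded_one eg4); lia.
    + by rewrite J4 (loaded_one eg4); lia.
  - move=> [eg gR gP gJ]; split; first by rewrite gJ subnn.
    by split=> //; rewrite gR /pradius take_size.
lia.
Qed.
Lemma spec_sizes h : (0 < n)%N -> loaded h -> h rRAD = (radius s)%:Z ->
  wp c_sizes (13 * n + 22)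
    (fun g => [/\ env s T 0 g, g rK = K%:Z & g rANS = 0]) h.
Proof.
move=> n0 e hR; have SM := stride_le_M n0 M_ge.
have sR : stride s = (radius s + radius s).+1 by [].
have BP : (0 < block s)%N by rewrite muln_gt0 n0.
have [KM BM] : (K <= M)%N /\ (block s <= M)%N.
  by move: M_ge; rewrite mulSn; clear -BP; nia.
have UP : (n <= 2 * uphalf n < n + 2)%N by rewrite uphalfE; clear; lia.
pose st := (stride s)%:Z; pose P j := (512 * 2 ^ j)%N.
have PS j : P j.+1 = (P j + P j)%N by rewrite /P expnS; clear; lia.
have KE : K = (n * P n)%N by rewrite /trials /P; clear; lia.
have P_le j : (j <= n)%N -> (P j <= P n)%N.
  by move=> jn; rewrite /P leq_mul2l leq_exp2l.
have PM : (P n <= M)%N by apply: leq_trans KM; rewrite KE leq_pmull.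
pose I1 j (g : memory) := [/\ loaded g, g rRAD = (radius s)%:Z, g rSTR = st,
  g rJ = (n - j)%N%:Z & g rBLK = (j * stride s)%N%:Z /\ g rPOW = (P j)%:Z].
pose I2 j (g : memory) := [/\ loaded g, g rRAD = (radius s)%:Z, g rSTR = st,
  g rJ = (n - j)%N%:Z & [/\ g rBLK = (block s)%:Z, g rPOW = (P n)%:Z &
    g rK = (j * P n)%N%:Z]].
pose I3 j (g : memory) := [/\ loaded g, g rRAD = (radius s)%:Z, g rSTR = st,
  g rJ = n%:Z - (2 * j)%N%:Z & [/\ g rBLK = (block s)%:Z, g rTMP = 2,
    g rK = K%:Z & g rT = (2 ^ j)%N%:Z]].
eapply wp_le.
  apply: wp_opS => //=; [lia|rewrite hR; lia|].
  apply: wp_opS => //=; [lia|rewrite hR (loaded_one e); lia|].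
  apply: wp_opS => //=; [lia|].
  apply: wp_opS => //=; [lia|apply: leq_trans (P_le 0%N isT) PM|].
  apply: wp_opS => //=; [lia|rewrite (loaded_len e) (loaded_zero e); lia|].
  apply: wp_seq; apply: (@wp_while _ _ _ _ _ _ n I1) => [|j g jn|g].
  - split=> /=; first by do !apply: loaded_upd => //.
    + by [].
    + by rewrite hR (loaded_one e) /st; lia.
    + by rewrite (loaded_len e) (loaded_zero e); lia.
    + by split; [rewrite mul0n|].
  - move=> [eg gR gS gJ [gB gP]]; split; first by rewrite gJ; lia.
    have RB := row_bound jn; rewrite mulSn in RB.
    have Pj := leq_trans (P_le _ jn) PM; rewrite PS in Pj.
    apply: wp_opS => //=; [lia|rewrite gB gS /st; lia|].
    apply: wp_opS => //=; [lia|rewrite gP; lia|].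
    apply: wp_op => //=; [lia|rewrite gJ (loaded_one eg); lia|].
    split=> /=; first by do !apply: loaded_upd => //.
    + by [].
    + by [].
    + by rewrite gJ (loaded_one eg); lia.
    + by split; [rewrite gB gS /st mulSn; lia|rewrite gP PS; lia].
  - move=> [eg gR gS gJ [gB gP]]; split; first by rewrite gJ subnn.
    apply: wp_opS => //=; [lia|].
    apply: wp_opS => //=; [lia|rewrite (loaded_len eg) (loaded_zero eg); lia|].
    apply: wp_seq; apply: (@wp_while _ _ _ _ _ _ n I2) => [|j g' jn|g'].
    + split=> /=; first by do !apply: loaded_upd => //.
      * by [].
      * by [].
      * by rewrite (loaded_len eg) (loaded_zero eg); lia.
      * by split; rewrite ?gP ?gB.
    + move=> {eg gR gS gJ gB gP}[eg gR gS gJ [gB gP gK]]; split; first by rewrite gJ; lia.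
      have KB : (P n + j * P n <= M)%N.
        by apply: leq_trans KM; rewrite KE -mulSn leq_mul2r jn orbT.
      apply: wp_opS => //=; [lia|rewrite gK gP; lia|].
      apply: wp_op => //=; [lia|rewrite gJ (loaded_one eg); lia|].
      split=> /=; first by do !apply: loaded_upd => //.
      * by [].
      * by [].
      * by rewrite gJ (loaded_one eg); lia.
      * by split; rewrite ?gP ?gB // gK mulSn; lia.
    + move=> {eg gR gS gJ gB gP}[eg gR gS gJ [gB gP gK]]; split; first by rewrite gJ subnn.
      apply: wp_opS => //=; [lia|lia|].
      apply: wp_opS => //=; [lia|rewrite (loaded_len eg) (loaded_zero eg); lia|].
      apply: wp_opS => //=; [lia|lia|].
      apply: wp_seq; apply: (@wp_while _ _ _ _ _ _ (uphalf n) I3) => [|j f jn|f].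
      * split=> /=; first by do !apply: loaded_upd => //.
        -- by [].
        -- by [].
        -- by rewrite (loaded_len eg) (loaded_zero eg); lia.
        -- by split; rewrite ?gB ?gK -?KE.
      * move=> {eg gR gS gJ gB gP gK}[eg gR gS gJ [gB gT gK gTT]].
        split; first by rewrite gJ; lia.
        have TM : (2 ^ j + 2 ^ j <= M)%N.
          by apply: leq_trans T_le; rewrite addnn -mul2n -expnS leq_exp2l.
        apply: wp_opS => //=; [lia|rewrite gTT; lia|].
        apply: wp_op => //=; [lia|rewrite gJ gT; lia|].
        split=> /=; first by do !apply: loaded_upd => //.
        -- by [].
        -- by [].
        -- by rewrite gJ gT; lia.
        -- by split; rewrite ?gB ?gT ?gK // gTT expnS; lia.
      * move=> {eg gR gS gJ gB gP gK}[eg gR gS gJ [gB gT gK gTT]].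
        split; first by rewrite gJ; lia.
        apply: wp_opS => //=; [lia|rewrite gR (loaded_zero eg); lia|].
        apply: wp_op => //=; [lia|].
        split=> //; case: eg => e1 e2 e3 e4 e5; split=> //=.
        -- by rewrite gR e2 mul0n addn0 addr0.
        -- move=> i lt; rewrite !ifF ?e5 //; clear -n0; lia.
clear -UP; lia.
Qed.

Definition main_time : nat :=
  (K * (T * (65 * n + 76) + 15) + 36 * n + 114)%N.

Lemma spec_main :
  wp c_main main_time
    (fun g => (g rANS != 0) = (0 < n)%N && solve s K T rnd) (nth 0 (n%:Z :: s)).
Proof.
eapply wp_le.
  apply: wp_when => /= [n0|n0]; last by rewrite -[0%N]/rANS (_ : n = 0%N) //; lia.
  have {}n0 : (0 < n)%N by lia.
  apply: wp_seq; apply: wp_mono (spec_boot n0) _ => g1 e1.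
  apply: wp_seq; apply: wp_mono (spec_copy n0 e1) _ => g2 e2.
  apply: wp_seq; apply: wp_mono (spec_radius n0 e2) _ => g3 [e3 R3].
  apply: wp_seq; apply: wp_mono (spec_sizes n0 e3 R3) _ => g4 [e4 K4 A4].
  apply: wp_mono (spec_trials n0 e4 K4 A4) _ => g5 ->.
  by rewrite n0 /=; case: (solve _ _ _ _).
rewrite /main_time; lia.
Qed.
End Boot.

(** * Bounds on random bits, space and time *)

Definition program_ess : program := compile 0 c_main.

(** With x the input size, at most 2^(2n+10) trials with blocks below 2^(n+x+2), and a factor 2 for
    the other terms, give 2^(3n+x+13), and 2n <= x. The same power of 2 bounds the contents of the
    cells. *)
Definition bits : {poly nat} := Poly [:: 13%N; 3%N].

Lemma bitsE x : bits.[x] = (3 * x + 13)%N.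
Proof. rewrite /bits horner_Poly /=; lia. Qed.

Lemma absz_bitlen (z : int) : (`|z|.+1 <= 2 ^ (bitlen z).-1)%N.
Proof. exact: trunc_log_ltn. Qed.

Lemma input_size_ge s : (2 * size s <= input_size s)%N.
Proof.
elim: s => [|z s IH]; rewrite /input_size ?big_nil // big_cons.
by rewrite -/(input_size s) /bitlen /=; lia.
Qed.

Lemma radius_le s : (radius s <= 2 ^ input_size s)%N.
Proof.
rewrite /radius /input_size; elim: s => [|z s IH]; first by rewrite !big_nil.
rewrite !big_cons expnD; have := absz_bitlen z.
have -> : (2 ^ bitlen z = 2 * 2 ^ (bitlen z).-1)%N by rewrite -expnS.
move: IH; set a := (2 ^ _)%N; set b := (2 ^ _)%N; nia.
Qed.

Lemma sizes_le s :
  ((trials (size s)).+1 * block s + 65 * size s + 64 <= 2 ^ bits.[input_size s])%N.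
Proof.
rewrite bitsE; have R := radius_le s; have L := input_size_ge s.
have N : (size s < 2 ^ size s)%N by apply: ltn_expl.
apply: (@leq_trans (2 ^ (3 * size s + input_size s + 13))); last first.
  by rewrite leq_exp2l //; lia.
have -> : (2 ^ (3 * size s + input_size s + 13) =
   2 * (2 ^ size s * 2 ^ size s * 2 ^ 10) * (2 ^ size s * 2 ^ input_size s * 2 ^ 2))%N.
  rewrite (_ : 3 * size s + input_size s + 13 =
    1 + (size s + size s + 10) + (size s + input_size s + 2))%N; last by lia.
  by rewrite !expnD expn1.
have I0 : (0 < 2 ^ input_size s)%N by rewrite expn_gt0.
have B : (block s + 1 <= 2 ^ size s * 2 ^ input_size s * 2 ^ 2)%N.
  rewrite /block /stride; move: N R I0; set a := size s; set b := radius s.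
  by set x := (2 ^ a)%N; set y := (2 ^ _)%N; rewrite (_ : 2 ^ 2 = 4)%N //; nia.
have T : ((trials (size s)).+1 <= 2 ^ size s * 2 ^ size s * 2 ^ 10)%N.
  rewrite /trials (_ : 2 ^ 10 = 2 * 512)%N //; move: N; set a := size s.
  by set x := (2 ^ a)%N; nia.
have S : (65 * size s + 64 <= 2 ^ size s * 2 ^ size s * 2 ^ 10)%N.
  rewrite (_ : 2 ^ 10 = 1024)%N //; move: N; set a := size s.
  by set x := (2 ^ a)%N; nia.
move: B T S; set a := block s; set b := (2 ^ _ * _ * 2 ^ 2)%N.
set c := (trials _).+1; set d := (2 ^ _ * _ * 2 ^ 10)%N.
set e := (65 * _ + 64)%N; rewrite -addnA -/e; clear; nia.
Qed.

Lemma step_halted P rnd c : halted P c -> step P rnd c = c.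
Proof. by rewrite /step /halted => H; rewrite onth_default. Qed.

(** A halted configuration is fixed by [step], so what [wp] provides up to the moment of halting
    persists at all later times. *)
Lemma run_main (s : seq int) (rnd : seq bool) :
  let c := run program_ess rnd s (main_time s) in
  [/\ halted program_ess c,
      accepts c = (0 < size s)%N && solve s (trials (size s)) (2 ^ uphalf (size s)) rnd
    & forall t, fits (65 * size s + 32) (2 ^ bits.[input_size s])
        (cells (run program_ess rnd s t))].
Proof.
have M_ge := sizes_le s; set M := (2 ^ bits.[_])%N in M_ge *.
have L := input_size_ge s.
have T_le : (2 ^ uphalf (size s) <= M)%N.
  by rewrite leq_exp2l // bitsE uphalfE; lia.
have F0 : fits (65 * size s + 32) M ((size s)%:Z :: s).
  split=> [|[|a]] /=; [lia|lia|].
  apply: leq_trans (entry_bound s a) _; apply: leq_trans (radius_le s) _.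
  by rewrite leq_exp2l // bitsE; lia.
have [t' [m' [le E F Q]]] := spec_main rnd (leqnn _) M_ge T_le [::] [::] erefl F0.
rewrite cat0s cats0 -[compile _ _]/program_ess -/(init s) in E F.
rewrite -[(size [::] + _)%N]/(len c_main) in E.
have H : halted program_ess (State (len c_main) m').
  by rewrite /halted size_compile.
have St k : iter k (step program_ess rnd) (State (len c_main) m') = State (len c_main) m'.
  by elim: k => //= k ->; rewrite step_halted.
have R t : (t' <= t)%N -> run program_ess rnd s t = State (len c_main) m'.
  by move=> let'; rewrite /run -(subnK let') iterD [iter t' _ _]E St.
split; rewrite ?R //.
move=> t; case: (leqP t t') => [/F//|lt].
by rewrite (R _ (ltnW lt)) -E; apply: F.
Qed.

Lemma space_fits A E c : fits A (2 ^ E) (cells c) -> (Defs.space c <= A * E.+2)%N.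
Proof.
move=> [sA vM]; rewrite /Defs.space.
apply: (@leq_trans (\sum_(z <- cells c) E.+2)).
  rewrite !big_seq; apply: leq_sum => z /(nthP 0)[i lt <-].
  rewrite /bitlen !ltnS -[X in (_ <= X)%N](@trunc_expnK 2 E) //.
  exact: leq_trunc_log.
by rewrite big_const_seq count_predT iter_addn_0 mulnC leq_mul2r sA orbT.
Qed.

Lemma solves_ess :
  monte_carlo_solves equal_subset_sum program_ess bits main_time.
Proof.
move=> s U m; split=> [r|]; first by have [] := run_main s r.
set D := equal_subset_sum _.
have DP : D <-> exists A B : {set 'I_(size s)}, incomparable A B /\ subsum A = subsum B.
  exact: equal_subset_sumP.
case: (pselect D) => [d|nd].
  have [A [B [iAB eAB]]] := DP.1 d.
  have n0 : (0 < size s)%N.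
    by move: iAB => /andP[/subsetPn[j _ _] _]; apply: leq_trans (ltn_ord j).
  have mK : (trials (size s) * block s <= m)%N.
    by apply: leq_trans (sizes_le s); rewrite mulSn; lia.
  have tP j : (j ^ 2 <= 2 ^ size s)%N -> (j <= 2 ^ uphalf (size s))%N.
    move=> H; rewrite -leq_sqr; apply: leq_trans H _.
    by rewrite -expnM leq_exp2l // uphalfE; lia.
  have := solve_complete n0 tP mK iAB eAB; congr (_ <= _).
  rewrite /prob; congr (_%:R / _); apply: eq_card => r; rewrite !inE.
  by have [_ -> _] := run_main s r; rewrite n0 asboolT // eqb_id.
(* Without a solution no choice of the bits leads to acceptance, so the answer is correct with
   probability 1. *)
rewrite /prob (_ : [set r | _] = [set: m.-tuple bool]%SET); last first.
  apply/setP => r; rewrite !inE; have [_ -> _] := run_main s r.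
  rewrite asboolF // eqbF_neg; apply/negP => /andP[_ /solve_sound H].
  by apply: nd; apply/DP.
rewrite cardsT divff; first lra.
by rewrite pnatr_eq0 -lt0n card_tuple expn_gt0 card_bool.
Qed.

Lemma space_ess : polynomial_space program_ess bits.
Proof.
(* The coefficients of (65 x + 32)(3 x + 15): number of cells times bits per cell, in the input size
   x. *)
exists (Poly [:: 480%N; 1071%N; 195%N]) => s _ r t.
have [_ _ /(_ t) F] := run_main s r.
apply: leq_trans (space_fits F) _.
rewrite bitsE horner_Poly /=; have := input_size_ge s.
set n := size s; set x := input_size s => H.
apply: (@leq_trans ((65 * x + 32) * (3 * x + 15))); last by nia.
by apply: leq_mul; lia.
Qed.

Lemma main_time_le s :
  (main_time s <= (512 * size s * (65 * size s + 91) + 36 * size s + 114) *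
     2 ^ (size s + uphalf (size s)))%N.
Proof.
rewrite /main_time /trials expnD; set n := size s.
have : (0 < 2 ^ n)%N by rewrite expn_gt0.
have : (0 < 2 ^ uphalf n)%N by rewrite expn_gt0.
set x := (2 ^ n)%N; set y := (2 ^ uphalf n)%N => y0 x0.
have xy : (0 < x * y)%N by rewrite muln_gt0 x0.
(* 91 = 76 + 15: the steps of a trial outside its loops are charged to the walk length, as y >=
   1. *)
have E : (512 * n * x * (y * (65 * n + 76) + 15) <= 512 * n * (65 * n + 91) * (x * y))%N.
  have -> : (512 * n * (65 * n + 91) * (x * y) = 512 * n * x * (y * (65 * n + 91)))%N by ring.
  by rewrite leq_mul2l; apply/orP; right; nia.
by rewrite -addnA -[X in (_ <= X * _)%N]addnA mulnDl leq_add ?leq_pmulr.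
Qed.

Lemma time_ess (R : realType) :
  Ostar (fun n : nat => (2 : R) `^ (3 / 2 * n%:R)) main_time.
Proof.
(* Twice the polynomial factor of [main_time_le]; the 2 absorbs the rounding, since n + [uphalf n]
   <= 3n/2 + 1. *)
pose c : {poly nat} := Poly [:: 228%N; (72 + 1024 * 91)%N; (1024 * 65)%N].
exists c => s _; set n := size s.
have LE := main_time_le s; rewrite -/n in LE.
apply: (@le_trans _ _ ((512 * n * (65 * n + 91) + 36 * n + 114) *
     2 ^ (n + uphalf n))%N%:R); first by rewrite ler_nat.
rewrite natrM natrX.
have P : (2 : R) ^+ (n + uphalf n) <= 2 * 2 `^ (3 / 2 * n%:R).
  rewrite -powR_mulrn // -{2}[2]powRr1 // -powRD; last by rewrite pnatr_eq0 implybT.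
  rewrite ler_powR ?ler1n // natrD.
  have : ((2 * uphalf n)%:R : R) <= (n + 1)%:R by rewrite ler_nat uphalfE; lia.
  by rewrite natrM natrD; lra.
apply: le_trans (ler_wpM2l _ P) _ => //.
rewrite mulrCA mulrA ler_wpM2r ?powR_ge0 // -natrM ler_nat.
rewrite /c horner_Poly /horner_rec.
have := input_size_ge s; rewrite -/n; set x := input_size s => H.
rewrite (_ : (_ + _)%R = (((1024 * 65) * x + (72 + 1024 * 91)) * x + 228)%N) //; nia.
Qed.

Lemma Ostar_28285 (R : realType) :
  (Ostar (fun n : nat => (2 : R) `^ (3 / 2 * n%:R))
     `<=` Ostar (fun n : nat => (2828 / 10 ^+ 3 + 5 / 10 ^+ 4 : R) ^+ n))%classic.
Proof.
move=> T [p Hp]; exists p => s U; apply: le_trans (Hp s U) _.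
apply: ler_wpM2l => //; rewrite powRrM powR_mulrn ?powR_ge0 //.
apply: lerXn2r; rewrite ?nnegrE ?powR_ge0 //; first by lra.
(* Squaring reduces the comparison of 2^(3/2) with 2.8285 to 8 <= 2.8285^2. *)
rewrite -(ler_pXn2r (_ : 0 < 2)%N) ?nnegrE ?powR_ge0 //; last by lra.
rewrite -powR_mulrn ?powR_ge0 // -powRrM (_ : 3 / 2 * 2%:R = 3%:R); last by lra.
by rewrite powR_mulrn //; lra.
Qed.

Theorem theorem5 (R : realType) :
  (exists (P : program) (q : {poly nat}) (T : seq int -> nat),
     [/\ monte_carlo_solves equal_subset_sum P q T,
         polynomial_space P q
       & Ostar (fun n : nat => (2 : R) `^ (3 / 2 * n%:R)) T]) /\
  (Ostar (fun n : nat => (2 : R) `^ (3 / 2 * n%:R))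
     `<=` Ostar (fun n : nat => (2828 / 10 ^+ 3 + 5 / 10 ^+ 4 : R) ^+ n))%classic.
Proof.
split; last exact: Ostar_28285.
exists program_ess, bits, main_time.
by split; [exact: solves_ess|exact: space_ess|exact: time_ess].
Qed.
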